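(* Let $n,k$ be integers with $k\geq 2$ and $n-k\geq 3$, and let $B_1,\dots,B_{2(n-k)-4}$ be the Bott matrices of size $n-1$ listed in the context. Then the real Bott manifolds $M(B_1),\dots,M(B_{2(n-k)-4})$ are all diffeomorphic to each other, and the number of diffeomorphism classes of $n$-dimensional real Bott manifolds of the form $M(A)=S^1\times_{\mathbb{Z}_2}M(B)$, with $B$ any one of the matrices $B_1,\dots,B_{2(n-k)-4}$, is $(k+1)2^{n-k-3}$.
   Context: A Bott matrix of size $n$ is an $n\times n$ upper triangular matrix $A=(a_{ij})$ with $a_{ii}=1$ for all $i$ and $a_{ij}\in\{0,1\}$ for $i<j$. Let $S^1\subset\mathbb{C}$ be the unit circle and $T^n=(S^1)^n$. A Bott matrix $A$ defines a free action of $(\mathbb{Z}_2)^n=\langle g_1,\dots,g_n\rangle$ on $T^n$ by $$g_i(z_1,\dots,z_n)=(z_1,\dots,z_{i-1},-z_i,\tilde z_{i+1},\dots,\tilde z_n),$$ where for $j>i$, $\tilde z_j=\bar z_j$ if $a_{ij}=1$ and $\tilde z_j=z_j$ if $a_{ij}=0$. The quotient smooth manifold $M(A)=T^n/(\mathbb{Z}_2)^n$ is called an ($n$-dimensional) real Bott manifold. For a Bott matrix $B$ of size $n-1$, the notation $M(A)=S^1\times_{\mathbb{Z}_2}M(B)$ means that $A=\begin{pmatrix}1& c\\ 0&B\end{pmatrix}$ for a row vector $c\in\{0,1\}^{n-1}$ such that each of the columns $2,\dots,n$ of $A$ has at least two nonzero entries. (For the matrices $B_j$ below this means exactly that the first entry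 of $c$ is $1$.) The list. Put $m=n-k-1$ (so $m\ge 2$ and $2(n-k)-4=2m-2$). Every $B_j$ has size $n-1=m+k$; its last $k$ rows are $(0\mid I_k)$, i.e. the lower right $k\times k$ block is $I_k$ and the lower left $k\times m$ block is $0$; and its $m$-th row has entries $1$ in columns $m,m+1,\dots,m+k$ and $0$ elsewhere. The rows $i=1,\dots,m-1$ are as follows. For $1\le j\le m$, in $B_j$: row $i$ with $i<j$ has entries $1$ exactly in columns $i,i+1$; row $i$ with $j\le i\le m-1$ has entries $1$ exactly in columns $i,i+1,\dots,m+k$. For $j=m+t$ with $1\le t\le m-2$, in $B_{j}$: row $i$ with $i<m-1-t$ has entries $1$ exactly in columns $i,i+1$; row $i$ with $m-1-t\le i\le m-1$ has entries $1$ exactly in columns $i,i+1,\dots,m$. (Thus $B_1$ has all entries $1$ on and to the right of the diagonal in its first $m$ rows, and in $B_{2m-2}$ with $m\geq 3$ the first $m-1$ rows have entries $1$ from the diagonal through column $m$ and $0$ in the last $k$ columns.) *)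

(* Defs.v *)
From HB Require Import structures.
From mathcomp Require Import all_boot all_order all_algebra generic_quotient.
From mathcomp Require Import complex.
From mathcomp Require Import all_classical all_reals all_analysis.

Set Implicit Arguments.
Unset Strict Implicit.
Unset Printing Implicit Defensive.

Import Order.TTheory GRing.Theory Num.Theory.
Import numFieldNormedType.Exports.

Local Open Scope classical_set_scope.
Local Open Scope ring_scope.
Local Open Scope quotient_scope.

(* [C^k] on an open set [U]; in finite dimension this is the usual notion,
   as ['d f x v = 'D_v f x] and there are finitely many basis directions. *)
Fixpoint Ck (R : realType) (V W : normedModType R) (k : nat)
    (U : set V) (f : V -> W) : Prop :=
  match k with
  | 0 => forall x, U x -> {for x, continuous f}
  | k'.+1 => (forall x, U x -> differentiable f x) /\
             (forall v : V, Ck k' U (fun x => 'D_v f x))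
  end.

Definition smooth_on (R : realType) (V W : normedModType R)
    (U : set V) (f : V -> W) : Prop :=
  forall k, Ck k U f.

Definition bott_matrix n (A : 'M[bool]_n) : bool :=
  [forall i, A i i] && [forall i : 'I_n, forall j : 'I_n, (j < i)%N ==> ~~ A i j].

Section Torus.
Variables (R : realType) (n : nat).

Definition unit_entries (z : 'rV[R[i]]_n) : bool :=
  [forall j, `|z 0 j| == 1].

Definition torus := {z : 'rV[R[i]]_n | unit_entries z}.

Lemma torus_exp_subproof (x : 'rV[R]_n) :
  unit_entries (\row_j (cos (x 0 j) +i* sin (x 0 j))%C).
Proof.
by apply/forallP => j; rewrite mxE normc_def /= cos2Dsin2 sqrtr1.
Qed.

Definition torus_exp (x : 'rV[R]_n) : torus :=
  exist (fun z => unit_entries z) _ (torus_exp_subproof x).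

Variable A : 'M[bool]_n.

Definition bott_gen_fun (i : 'I_n) (z : 'rV[R[i]]_n) : 'rV[R[i]]_n :=
  \row_j (if j == i then - z 0 j
          else if (i < j)%N && A i j then (z 0 j)^* else z 0 j).

Lemma bott_gen_subproof (i : 'I_n) (z : torus) :
  unit_entries (bott_gen_fun i (val z)).
Proof.
apply/forallP => j; rewrite mxE; have /forallP/(_ j) := valP z.
by case: ifP => _; [rewrite normrN | case: ifP => _; rewrite ?norm_conjC].
Qed.

Definition bott_gen (i : 'I_n) (z : torus) : torus :=
  exist (fun z => unit_entries z) _ (bott_gen_subproof i z).

Lemma bott_genK i : involutive (bott_gen i).
Proof.
move=> z; apply/val_inj/rowP => j; rewrite !mxE.
case: (j == i); first by rewrite opprK.
by case: (_ && _); rewrite ?conjCK.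
Qed.

(* As every [g_i] is an involution, the orbits of the group generated by the
   [g_i] are those of words in the [g_i]. *)
Definition bott_orbit_rel (z w : torus) : bool :=
  `[< exists s : seq 'I_n, w = foldr bott_gen z s >].

Lemma bott_orbit_refl : reflexive bott_orbit_rel.
Proof. by move=> z; apply/asboolP; exists [::]. Qed.

Lemma bott_orbit_trans : transitive bott_orbit_rel.
Proof.
move=> w z u /asboolP[s ->] /asboolP[t ->]; apply/asboolP.
by exists (t ++ s); rewrite foldr_cat.
Qed.

Lemma bott_orbit_sym : symmetric bott_orbit_rel.
Proof.
suff h z w : bott_orbit_rel z w -> bott_orbit_rel w z.
  by move=> z w; apply/idP/idP; exact: h.
move=> /asboolP[s ->]; elim: s => [|i s IHs] /=; first exact: bott_orbit_refl.
apply: bott_orbit_trans IHs; apply/asboolP; exists [:: i] => /=.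
by rewrite bott_genK.
Qed.

Canonical bott_orbit_equiv :=
  EquivRel bott_orbit_rel bott_orbit_refl bott_orbit_sym bott_orbit_trans.

Definition real_bott := {eq_quot bott_orbit_rel}.

Definition bott_cover (x : 'rV[R]_n) : real_bott :=
  \pi_({eq_quot bott_orbit_rel}) (torus_exp x).

(* [R^n -> T^n -> M(A)] is a covering, and the smooth structure of [M(A)] is
   the one making it a local diffeomorphism: the charts are the inverses of
   [bott_cover] on the open sets where it is injective. *)
Definition chart_domain (U : set 'rV[R]_n) : Prop :=
  open U /\ {in U &, injective bott_cover}.

End Torus.

Definition smooth_map (R : realType) m n (A : 'M[bool]_m) (B : 'M[bool]_n)
    (f : real_bott R A -> real_bott R B) : Prop :=
  forall p : real_bott R A,
  exists (U : set 'rV[R]_m) (V : set 'rV[R]_n) (F : 'rV[R]_m -> 'rV[R]_n),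
    [/\ chart_domain A U /\ (bott_cover A @` U) p,
        chart_domain B V /\ F @` U `<=` V,
        smooth_on U F
      & forall x, U x -> f (bott_cover A x) = bott_cover B (F x)].

Definition diffeomorphic (R : realType) m n
    (A : 'M[bool]_m) (B : 'M[bool]_n) : Prop :=
  exists (f : real_bott R A -> real_bott R B)
         (g : real_bott R B -> real_bott R A),
    [/\ cancel f g, cancel g f, smooth_map f & smooth_map g].

(* [M(A) = S^1 x_{Z_2} M(B)]; the first column of [A] has index [0]. *)
Definition circle_bundle_form n (A : 'M[bool]_(1 + n)) (B : 'M[bool]_n) : bool :=
  [exists c : 'rV[bool]_n,
     A == block_mx (const_mx true) c (const_mx false) B]
  && [forall j : 'I_(1 + n), (0 < j)%N ==> (2 <= #|[set i | A i j]%SET|)%N].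

(* The entries of [B_j], with [m = n - k - 1] and row and column indices
   [r], [c] starting from [1]. *)
Definition bott_list_entry (m j r c : nat) : bool :=
  if (m < r)%N then c == r
  else if r == m then (m <= c)%N
  else if (j <= m)%N then
    if (r < j)%N then (c == r) || (c == r.+1) else (r <= c)%N
  else
    if (r < m - 1 - (j - m))%N then (c == r) || (c == r.+1)
    else (r <= c <= m)%N.

Definition bott_list (n k j : nat) : 'M[bool]_n.-1 :=
  \matrix_(r, c) bott_list_entry (n - k - 1) j r.+1 c.+1.

Lemma bott_list_bott n k j : bott_matrix (bott_list n k j).
Proof.
apply/andP; split; apply/forallP => r; last first.
  apply/forallP => c; apply/implyP => ltcr; rewrite mxE /bott_list_entry.
  have nrc : c.+1 == r.+1 = false by rewrite eqSS ltn_eqF.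
  have nrc1 : c.+1 == r.+2 = false by rewrite eqSS ltn_eqF // leqW.
  have nle : (r.+1 <= c.+1)%N = false by rewrite ltnNge ltcr.
  rewrite nrc nrc1 nle /=.
  case: ifP => // _; case: eqP => [<-|_]; first by rewrite nle.
  by case: ifP => _; case: ifP.
rewrite mxE /bott_list_entry !eqxx ltnSn.
case: ifP => // /negbT; rewrite -leqNgt => ->.
by case: eqP => [<-|_]; rewrite ?leqnn //; case: ifP => _; case: ifP.
Qed.

(* Main.v *)
(* The covering R^n -> T^n -> M(A) has deck group Z^n with the twisted law
   (k * l)_j = k_j + (-1)^(sum_(i < j) a_ij k_i) l_j.  A diffeomorphism lifts to
   R^n, hence induces an isomorphism phi of deck groups.  Modulo 2, phi is an
   invertible matrix P over F_2, and the relations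
   g_i g_l = g_l^(+-1) g_i (i < l) force, with u = P e_j and w = P (column j of A),
     u_i w_l + u_l w_i = b_il u_l (1 + w_l),
   the vanishing of the cup product u (u + w).

   Conversely, translating the v-th coordinate of R^n by pi/2 replaces the
   digraph of A by its local complement at v, and permuting coordinates
   permutes vertices.  In B_j the rows satisfy
   row_i = e_(i+1) + eps_i row_(i+1), and local complementation at i + 1 flips
   eps_i; so every A in the family is equivalent to a matrix in which rows
   1, ..., m form the path 1 -> ... -> m -> sinks.  What is left of row 0, after
   one more complementation at vertex 1 making its entry in column 2 vanish, is
   m - 2 free bits and the number, between 0 and k, of sinks it reaches; the
   relations above show that these data are invariants. *)

Require Import Defs.
From mathcomp Require Import all_boot all_order all_algebra fingroup perm.
From mathcomp Require Import generic_quotient complex.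
From mathcomp Require Import all_classical all_reals all_analysis.
From mathcomp Require Import zify ring lra.

Set Implicit Arguments.
Unset Strict Implicit.
Unset Printing Implicit Defensive.

Import Order.TTheory GRing.Theory Num.Theory.
Import numFieldNormedType.Exports.

Local Open Scope classical_set_scope.
Local Open Scope ring_scope.
Local Open Scope quotient_scope.

(** * The deck group *)

Definition edge n (A : 'M[bool]_n) (i j : 'I_n) : bool := (i < j)%N && A i j.

(** [bool] serves as the field with two elements, so that [%:~R] is reduction modulo 2. *)
Definition parity n (k : 'rV[int]_n) : 'rV[bool]_n := \row_i (k 0 i)%:~R.

Definition flip n (A : 'M[bool]_n) (k : 'rV[int]_n) (j : 'I_n) : bool :=
  \sum_i parity k 0 i * edge A i j.

Definition deck_mul n (A : 'M[bool]_n) (k l : 'rV[int]_n) : 'rV[int]_n :=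
  \row_j (k 0 j + (-1) ^+ flip A k j * l 0 j).

(** Coordinates of R^n are angles and the lattice unit is pi, since g_i lifts to a shift by pi in
    coordinate i; the deck group of R^n -> T^n consists of the even vectors. *)
Definition deck (R : realType) n (A : 'M[bool]_n) (k : 'rV[int]_n)
    (x : 'rV[R]_n) : 'rV[R]_n :=
  \row_j ((-1) ^+ flip A k j * x 0 j + pi * (k 0 j)%:~R).

Lemma intr_signM (b : bool) (c : int) : ((-1) ^+ b * c)%:~R = c%:~R :> bool.
Proof. by case: b; rewrite ?expr1 ?expr0 ?mulN1r ?mul1r // mulrNz. Qed.

Section DeckGroup.
Variables (n : nat) (A : 'M[bool]_n).
Implicit Types (i j : 'I_n) (k l : 'rV[int]_n).

Lemma parity_mul k l : parity (deck_mul A k l) = parity k + parity l.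
Proof. by apply/rowP => j; rewrite !mxE rmorphD /= intr_signM. Qed.

Lemma flip_mul k l j : flip A (deck_mul A k l) j = flip A k j + flip A l j.
Proof.
rewrite /flip -big_split; apply: eq_bigr => i _.
by rewrite parity_mul mxE mulrDl.
Qed.

Lemma parity0 : parity (0 : 'rV[int]_n) = 0.
Proof. by apply/rowP => j; rewrite !mxE. Qed.

Lemma parity_delta i : parity (delta_mx 0 i) = delta_mx 0 i.
Proof. by apply/rowP => j; rewrite !mxE; case: eqP => //=; case: eqP. Qed.

Lemma flip_parity0 k j : parity k = 0 -> flip A k j = false.
Proof. by move=> k0; rewrite /flip big1 // => i _; rewrite k0 mxE mul0r. Qed.

Lemma flip0 j : flip A 0 j = false.
Proof. by rewrite flip_parity0 ?parity0. Qed.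

Lemma flip_delta i j : flip A (delta_mx 0 i) j = edge A i j.
Proof.
rewrite /flip parity_delta (bigD1 i) //= big1 ?addr0 ?mxE ?eqxx ?mul1r // => l li.
by rewrite mxE (negbTE li) andbF mul0r.
Qed.

Lemma sgnD (S : pzRingType) (a b : bool) :
  (-1) ^+ (a + b : bool)%R = (-1) ^+ a * (-1) ^+ b :> S.
Proof. by case: a; case: b; rewrite ?expr0 ?expr1 ?mulr1 ?mul1r ?mulrNN ?mulr1. Qed.

Lemma mul0_deck k : deck_mul A 0 k = k.
Proof. by apply/rowP => j; rewrite !mxE flip0 mul1r add0r. Qed.

Lemma deck_mulA k l h :
  deck_mul A k (deck_mul A l h) = deck_mul A (deck_mul A k l) h.
Proof. by apply/rowP => j; rewrite !mxE flip_mul sgnD mulrDr mulrA addrA. Qed.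

Definition deck_inv k : 'rV[int]_n := \row_j (- ((-1) ^+ flip A k j * k 0 j)).

Lemma parity_inv k : parity (deck_inv k) = parity k.
Proof.
by apply/rowP => j; rewrite !mxE rmorphN /= intr_signM; case: (intr _).
Qed.

Lemma flip_inv k j : flip A (deck_inv k) j = flip A k j.
Proof. by rewrite /flip parity_inv. Qed.

Lemma mul_deckV k : deck_mul A k (deck_inv k) = 0.
Proof. by apply/rowP => j; rewrite !mxE mulrN signrMK subrr. Qed.

Lemma mulV_deck k : deck_mul A (deck_inv k) k = 0.
Proof. by apply/rowP => j; rewrite !mxE flip_inv addNr. Qed.

(** Induction on the sum of the |k_i|: a generator or its inverse brings a nonzero entry closer to 0
    and changes the others at most in sign. The equivalence in the hypothesis covers both. *)
Lemma deck_ind (P : 'rV[int]_n -> Prop) : P 0 ->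
  (forall i k, P (deck_mul A (delta_mx 0 i) k) <-> P k) -> forall k, P k.
Proof.
move=> P0 Pi k.
have [N] := ubnP (\sum_i `|k 0%R i|)%N; elim: N k => // N IHN k.
rewrite ltnS => kN.
have [k0|[i ki]] : k = 0 \/ exists i, k 0 i != 0.
  have [/existsP[i ki]|/existsPn k0] := boolP [exists i, k 0 i != 0].
    by right; exists i.
  by left; apply/rowP => i; rewrite mxE; apply/eqP/negPn/k0.
  by rewrite k0.
have edge_ii : edge A i i = false by rewrite /edge ltnn.
have lt_abs l : (`|l 0%R i| < `|k 0%R i|)%N ->
    (forall j, j != i -> `|l 0%R j| = `|k 0%R j|)%N -> P l.
  move=> li lj; apply: IHN; apply: leq_trans kN.
  rewrite (bigD1 i) //= [leqRHS](bigD1 i) //=.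
  rewrite -addSn leq_add // leq_sum // => j ji; by rewrite lj.
have deltaj j : j != i -> (delta_mx 0 i : 'rV[int]_n) 0 j = 0.
  by move=> ji; rewrite mxE (negbTE ji) andbF.
have deltai : (delta_mx 0 i : 'rV[int]_n) 0 i = 1 by rewrite mxE !eqxx.
have [kipos|kineg|ki0] := ltrgt0P (k 0 i); last by rewrite ki0 eqxx in ki.
- have -> : k = deck_mul A (delta_mx 0 i)
      (deck_mul A (deck_inv (delta_mx 0 i)) k).
    by rewrite deck_mulA mul_deckV mul0_deck.
  apply/Pi/lt_abs => [|j ji].
    rewrite !mxE flip_inv flip_delta edge_ii !eqxx /= !expr0 !mul1r.
    lia.
  rewrite !mxE flip_inv flip_delta (negbTE ji) andbF mulr0 oppr0 add0r.
  by case: (edge A i j); rewrite ?mul1r // mulN1r abszN.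
- apply/(Pi i)/lt_abs => [|j ji].
    by rewrite !mxE flip_delta edge_ii !eqxx /= mul1r; lia.
  rewrite !mxE flip_delta (negbTE ji) andbF add0r.
  by case: (edge A i j); rewrite ?mul1r // mulN1r abszN.
Qed.

Lemma deck_comm i j : (i < j)%N -> edge A i j = false ->
  deck_mul A (delta_mx 0 i) (delta_mx 0 j) =
  deck_mul A (delta_mx 0 j) (delta_mx 0 i).
Proof.
move=> ij Eij; apply/rowP => l; rewrite !mxE !flip_delta.
have [->|li] := eqVneq l i; first by
  rewrite /edge [(j < i)%N]ltnNge (ltnW ij) /= ?eqxx -val_eqE /= ltn_eqF // mulr0 add0r addr0.
have [->|lj] := eqVneq l j; first by rewrite Eij /= mul1r mulr0 addr0 add0r.
by rewrite !mulr0.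
Qed.

Lemma deck_flip i j : edge A i j ->
  deck_mul A (delta_mx 0 j)
    (deck_mul A (delta_mx 0 i) (delta_mx 0 j)) = delta_mx 0 i.
Proof.
move=> Eij; have /andP[ij _] := Eij.
apply/rowP => l; rewrite !mxE !flip_delta.
have [->|li] := eqVneq l i; first by
  rewrite /edge [(j < i)%N]ltnNge (ltnW ij) /= -val_eqE /= ltn_eqF // mulr0 add0r addr0.
have [->|lj] := eqVneq l j; first by rewrite Eij /edge ltnn; case: eqP.
by rewrite !mulr0.
Qed.

Lemma flip_head k k' j : (forall i, (i < j)%N -> k 0 i = k' 0 i) ->
  flip A k j = flip A k' j.
Proof.
move=> kk'; apply: eq_bigr => i _; rewrite /edge.
by case: ltnP => ij; rewrite ?mulr0 // !mxE kk'.
Qed.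

Variable R : realType.
Implicit Types x y : 'rV[R]_n.

Lemma deck0 x : deck A 0 x = x.
Proof. by apply/rowP => j; rewrite !mxE flip0 mul1r mulr0 addr0. Qed.

Lemma deckM k l x : deck A (deck_mul A k l) x = deck A k (deck A l x).
Proof.
apply/rowP => j; rewrite !mxE flip_mul sgnD rmorphD /= rmorphM rmorphXn rmorphN /=.
by rewrite rmorph1 !mulrDr -addrA -mulrA; congr (_ + _); rewrite addrC mulrCA.
Qed.

(** At the first index where [k] and [k'] differ the signs agree, by [flip_head], so the two points
    differ there by a nonzero integer multiple of pi. *)
Lemma deck_sep k k' x : k != k' ->
  exists j, pi <= `|deck A k x 0 j - deck A k' x 0 j|.
Proof.
move=> kk'; have /existsP[i0 ki0] : [exists i, k 0 i != k' 0 i].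
  apply: contraNT kk' => /existsPn kk'; apply/eqP/rowP => i.
  by apply/eqP/negPn/kk'.
case: (@arg_minnP _ i0 (fun i => k 0 i != k' 0 i) (fun i => i) ki0) => j kj jmin.
exists j; rewrite !mxE (@flip_head k k') => [|i ij]; last first.
  by apply/eqP; apply: contraTT ij => /jmin; rewrite -leqNgt.
rewrite opprD addrACA subrr add0r -mulrBr -rmorphB /= normrM.
rewrite ger0_norm ?pi_ge0 // ler_peMr ?pi_ge0 // -intr_norm.
rewrite (ler_int _ 1); move: kj; rewrite -subr_eq0; lia.
Qed.

Lemma deck_inj k k' x : deck A k x = deck A k' x -> k = k'.
Proof.
move=> kk'; apply/eqP; case: (eqVneq k k') => // /(deck_sep x)[j].
by rewrite kk' subrr normr0 leNgt pi_gt0.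
Qed.

End DeckGroup.

(** * The covering of a real Bott manifold *)

Section Cover.
Variable R : realType.

(** After reduction to 0 <= s < 2 pi, use cos s = 1 - 2 sin^2 (s / 2) and the positivity of sin
    strictly between 0 and pi. *)
Lemma cos_eq1 (r : R) : cos r = 1 -> exists k : int, r = pi *+ 2 * k%:~R.
Proof.
move=> cr; have pi2 : 0 < pi *+ 2 :> R by rewrite mulrn_wgt0 // pi_gt0.
pose k := Num.floor (r / (pi *+ 2)); exists k; pose s := r - pi *+ 2 * k%:~R.
have /andP[s0 s2] : 0 <= s < pi *+ 2.
  have := floor_itv (r / (pi *+ 2)); rewrite -/k.
  rewrite ler_pdivlMr // ltr_pdivrMr // intrD mulrDl mul1r /s [_ * (_ *+ 2)]mulrC.
  by move=> /andP[h1 h2]; rewrite subr_ge0 h1 ltrBlDl.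
suff : s = 0 by move/eqP; rewrite subr_eq0 => /eqP.
have cs : cos s = 1.
  have per (t : R) (m : nat) : cos (t + (pi *+ 2) * m%:R) = cos t.
    by rewrite mulr_natr; apply: (periodicn (@cosD2pi R)).
  rewrite /s -[RHS]cr; case: (k) => m.
    by rewrite -[in RHS](subrK (pi *+ 2 * m%:R) r) per.
  by rewrite NegzE intrN mulrN opprK per.
have : sin (s / 2) ^+ 2 = 0.
  move: cs; rewrite {1}(_ : s = (s / 2) *+ 2); last by rewrite -mulr_natr mulfVK.
  by rewrite cos_mulr2n cos2sin2; lra.
move/eqP; rewrite sqrf_eq0 => /eqP s20.
apply/eqP; case: eqVneq => // sn0.
have : 0 < sin (s / 2).
  apply: sin_gt0_pi; apply/andP; split.
    by rewrite divr_gt0 // lt_neqAle eq_sym sn0.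
  by rewrite ltr_pdivrMr // mulr_natr.
by rewrite s20 ltxx.
Qed.

Section Fixed.
Variables (n : nat) (A : 'M[bool]_n).
Implicit Types (x y : 'rV[R]_n) (i j : 'I_n).

Lemma bott_gen_exp i x :
  bott_gen A i (torus_exp x) = torus_exp (deck A (delta_mx 0 i) x).
Proof.
apply/val_inj/rowP => j; rewrite !mxE flip_delta.
have [->|ji] := eqVneq j i.
  by rewrite /edge ltnn expr0 mul1r mulr1 cosDpi sinDpi.
rewrite /edge; case: (_ && _) => /=; rewrite mulr0 addr0 ?mul1r // mulN1r.
by rewrite cosN sinN.
Qed.

Lemma bott_cover_gen i x :
  bott_cover A (deck A (delta_mx 0 i) x) = bott_cover A x.
Proof.
rewrite /bott_cover -bott_gen_exp; apply/eqmodP => /=.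
by apply/asboolP; exists [:: i]; rewrite /= bott_genK.
Qed.

Lemma bott_cover_deck k x : bott_cover A (deck A k x) = bott_cover A x.
Proof.
move: k x; apply: (deck_ind (A := A)) => [x|i k]; first by rewrite deck0.
by split=> h x; rewrite -[RHS]h deckM bott_cover_gen.
Qed.

Lemma torus_exp_inj x y : torus_exp x = torus_exp y ->
  exists k, y = deck A k x.
Proof.
move=> /(congr1 val) /= exy.
have /choice[k kP] j : exists k : int, y 0 j - x 0 j = pi *+ 2 * k%:~R.
  apply: cos_eq1; rewrite cosB.
  have := congr1 (fun M : 'rV[_]_n => M 0 j) exy; rewrite !mxE => -[-> ->].
  by rewrite -!expr2 cos2Dsin2.
(* An even vector has parity 0, so it reflects nothing and acts as a translation. *)
exists (\row_j (k j *+ 2)); apply/rowP => j; rewrite !mxE flip_parity0.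
  by rewrite mul1r rmorphMn /= mulrnAr -mulrnAl -kP addrC subrK.
by apply/rowP => i; rewrite !mxE rmorphMn /=; case: (intr _).
Qed.

(** Words in the g_i lift to deck transformations, and [torus_exp_inj] accounts for the remaining
    choice of angles. *)
Lemma bott_coverP x y :
  bott_cover A x = bott_cover A y <-> exists k, y = deck A k x.
Proof.
split=> [/eqmodP/asboolP[s sP]|[k ->]]; last by rewrite bott_cover_deck.
have [k kP] : exists k,
    foldr (bott_gen A) (torus_exp x) s = torus_exp (deck A k x).
  elim: s {sP} => [|i s [k /= ->]]; first by exists 0; rewrite deck0.
  by exists (deck_mul A (delta_mx 0 i) k); rewrite bott_gen_exp deckM.
have /torus_exp_inj[l lP] : torus_exp (deck A k x) = torus_exp y.
  by rewrite sP.
by exists (deck_mul A l k); rewrite deckM.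
Qed.

Lemma bott_cover_surj p : exists x, bott_cover A x = p.
Proof.
pose z := repr p; have [x xP] : exists x, torus_exp x = z.
  have /choice[x xP] j : exists t : R, ((cos t) +i* (sin t))%C = val z 0 j.
    have /forallP/(_ j) := valP z; case: (val z 0 j) => a b.
    rewrite normc_def /= => /eqP[] /(congr1 (fun u => u ^+ 2)).
    rewrite expr1n sqr_sqrtr ?addr_ge0 ?sqr_ge0 // => ab.
    have a1 : -1 <= a <= 1.
      by apply/andP; split; nra.
    have sb : Num.sqrt (1 - a ^+ 2) = `|b| by rewrite -ab addrC addKr sqrtr_sqr.
    have [b0|b0] := leP 0 b.
      by exists (acos a); rewrite acosK // sin_acos // sb ger0_norm.
    by exists (- acos a); rewrite cosN sinN acosK // sin_acos // sb ltr0_norm // opprK.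
  by exists (\row_j x j); apply/val_inj/rowP => j; rewrite !mxE xP.
by exists x; rewrite /bott_cover xP reprK.
Qed.

Lemma bott_cover_sep x y : bott_cover A x = bott_cover A y -> x != y ->
  exists j, pi <= `|x 0 j - y 0 j|.
Proof.
move=> /bott_coverP[k ->]; rewrite -{1}(deck0 A x) => xk.
have : 0 != k by apply: contraNneq xk => <-; rewrite eqxx.
by move=> /(deck_sep A x)[j]; rewrite deck0; exists j.
Qed.

End Fixed.
End Cover.

(** * Affine equivalence *)

Section MatrixTopology.
Variable R : realType.

Lemma rV_cvg (T : Type) (F : set_system T) n (f : T -> 'rV[R]_n) (l : 'rV[R]_n)
    {FF : Filter F} :
  (forall j, (fun x => f x 0 j) @ F --> l 0 j) -> f @ F --> l.
Proof.
move=> fl; apply/cvg_ballP => e e0.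
have : \forall x \near F, forall j, ball (l 0 j) e (f x 0 j).
  by apply: filter_forall => j; have /cvg_ballP/(_ e e0) := fl j.
by apply: filterS => x xP; split => // i j; rewrite ord1.
Qed.

Lemma mulmxr_continuous m n (P : 'M[R]_(m, n)) :
  continuous (fun x : 'rV[R]_m => x *m P).
Proof.
move=> x; apply: (@rV_cvg _ (nbhs x)) => j.
rewrite [X in _ --> X](_ : _ = \sum_i x 0 i * P i j); last by rewrite mxE.
under eq_fun do rewrite mxE.
elim: (index_enum _) => [|i r IHr].
  by rewrite big_nil; under eq_fun do rewrite big_nil; exact: cvg_cst.
rewrite [X in X @ _](_ : _ = fun y : 'rV[R]_m =>
  y 0 i * P i j + \sum_(i <- r) y 0 i * P i j); last first.
  by apply/funext => y; rewrite big_cons.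
rewrite big_cons.
apply: cvgD => //; apply: cvgM; last exact: cvg_cst.
exact: coord_continuous.
Qed.

Lemma smooth_on_cst (V W : normedModType R) (U : set V) (w : W) :
  smooth_on U (cst w).
Proof.
move=> k; elim: k w => [|k IHk] w; first by move=> x _; exact: cst_continuous.
split=> [x _|v]; first exact: differentiable_cst.
rewrite [X in Ck _ _ X](_ : _ = cst 0); first exact: IHk.
by apply/funext => x; rewrite derive_cst.
Qed.

Definition affine m n (P : 'M[R]_(m, n)) (t : 'rV[R]_n) (x : 'rV[R]_m) := x *m P + t.

Lemma is_diff_affine m n (P : 'M[R]_(m, n)) t x :
  is_diff x (affine P t) (mulmxr P).
Proof.
rewrite [X in is_diff _ _ X](_ : _ = (mulmxr P : _ -> _) + 0); last first.
  by apply/funext => y /=; rewrite /GRing.add /= addr0.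
have -> : affine P t = (mulmxr P : _ -> _) + cst t by [].
apply: is_diffD.
apply: DiffDef; first exact/linear_differentiable/mulmxr_continuous.
by rewrite diff_lin //; exact: mulmxr_continuous.
Qed.

Lemma affine_continuous m n (P : 'M[R]_(m, n)) t : continuous (affine P t).
Proof.
by move=> x; apply: differentiable_continuous; have [] := is_diff_affine P t x.
Qed.

Lemma smooth_on_affine m n (P : 'M[R]_(m, n)) t U : smooth_on U (affine P t).
Proof.
move=> [x _|k]; first exact: affine_continuous.
split=> [x _|v]; first by have [] := is_diff_affine P t x.
rewrite [X in Ck _ _ X](_ : _ = cst (v *m P)); first exact: smooth_on_cst.
apply/funext => x; have [dP dE] := is_diff_affine P t x.
by rewrite deriveE // dE.
Qed.

End MatrixTopology.

Section AffineEquivalence.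
Variable R : realType.

(** Two points of a ball of radius 1 are less than 2 <= pi apart in each coordinate, too close to
    share a fibre. *)
Lemma chart_domain_ball n (A : 'M[bool]_n) (x : 'rV[R]_n) :
  chart_domain A (ball x 1).
Proof.
split; first exact: ball_open.
move=> y z; rewrite !inE => -[_ xy] [_ xz] yz.
apply/eqP; apply: contraT => /(bott_cover_sep yz)[j].
rewrite leNgt => /negP[]; apply: lt_le_trans (pi_ge2 R).
rewrite -[_ - _](subrKA (x 0 j)).
apply: le_lt_trans (ler_normD _ _) _.
by apply: ltrD; [rewrite distrC; exact: xy | exact: xz].
Qed.

(** Formulated on fibres, so that the affine bijection and its inverse descend to the quotients
    without an explicit isomorphism of deck groups. *)
Definition affine_equivalent n (A B : 'M[bool]_n) : Prop :=
  exists2 P : 'M[R]_n, P \in unitmx & exists t : 'rV[R]_n, forall x y,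
    bott_cover A x = bott_cover A y <->
    bott_cover B (affine P t x) = bott_cover B (affine P t y).

Section Fixed.
Variable n : nat.
Implicit Types A B C : 'M[bool]_n.

Lemma affine_equivalent_refl A : affine_equivalent A A.
Proof.
exists 1%:M; first exact: unitmx1.
by exists 0 => x y; rewrite /affine !mulmx1 !addr0.
Qed.

Lemma affine_equivalent_sym A B : affine_equivalent A B -> affine_equivalent B A.
Proof.
move=> [P Pu [t tP]]; exists (invmx P); first by rewrite unitmx_inv.
exists (- t *m invmx P) => x y; rewrite tP /affine.
by rewrite -!mulmxDl !mulmxKV // !subrK.
Qed.

Lemma affine_equivalent_trans A B C :
  affine_equivalent A B -> affine_equivalent B C -> affine_equivalent A C.
Proof.
move=> [P Pu [t tP]] [Q Qu [s sP]].
exists (P *m Q); first by rewrite unitmx_mul Pu.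
exists (t *m Q + s) => x y; rewrite tP sP /affine.
by rewrite !mulmxDl !mulmxA !addrA.
Qed.

Lemma affine_equivalent_smooth A B (P : 'M[R]_n) t (f : real_bott R A -> real_bott R B) :
  (forall x, f (bott_cover A x) = bott_cover B (affine P t x)) -> smooth_map f.
Proof.
move=> fP p; have [x xp] := bott_cover_surj p.
exists (ball x 1 `&` affine P t @^-1` (ball (affine P t x) 1)).
exists (ball (affine P t x) 1), (affine P t); split=> //.
- have [ox ix] := chart_domain_ball A x; split; last first.
    exists x => //; split; last exact: ballxx.
    exact: ballxx.
  split; last by move=> y z; rewrite !inE => -[xy _] [xz _]; apply: ix; rewrite inE.
  apply: openI => //; apply: open_comp; last exact: ball_open.
  by move=> y _; exact: affine_continuous.
- by split; [exact: chart_domain_ball | move=> _ [y [_ yP] <-]].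
- exact: smooth_on_affine.
Qed.

Lemma affine_equivalent_diffeomorphic A B :
  affine_equivalent A B -> diffeomorphic R A B.
Proof.
move=> [P Pu [t tP]].
(* [s] picks an arbitrary point of each fibre; [f] and [g] do not depend on it, because fibres go to
   fibres. *)
pose s A p := projT1 (cid (@bott_cover_surj R n A p)).
have sK A' p : bott_cover A' (s A' p) = p by rewrite /s; case: cid.
pose f (p : real_bott R A) := bott_cover B (affine P t (s A p)).
pose g (q : real_bott R B) := bott_cover A (affine (invmx P) (- t *m invmx P) (s B q)).
have PK x : affine (invmx P) (- t *m invmx P) (affine P t x) = x.
  by rewrite /affine -mulmxDl addrK mulmxK.
have PVK x : affine P t (affine (invmx P) (- t *m invmx P) x) = x.
  by rewrite /affine -mulmxDl mulmxKV // subrK.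
have fE x : f (bott_cover A x) = bott_cover B (affine P t x).
  by apply/tP; rewrite sK.
have gE x : g (bott_cover B x) = bott_cover A (affine (invmx P) (- t *m invmx P) x).
  by apply/tP; rewrite !PVK sK.
exists f, g; split.
- by move=> p; rewrite -(sK _ p) fE gE PK.
- by move=> p; rewrite -(sK _ p) gE fE PVK.
- exact: affine_equivalent_smooth fE.
- exact: affine_equivalent_smooth gE.
Qed.

End Fixed.
End AffineEquivalence.

(** * Local complementation and permutations *)

Section Moves.
Variable R : realType.

Definition local_complement n (v : 'I_n) (A : 'M[bool]_n) : 'M[bool]_n :=
  \matrix_(i, j) (A i j (+) (edge A i v && edge A v j)).

Section Fixed.
Variable n : nat.
Implicit Types (A B : 'M[bool]_n) (v i j : 'I_n) (x y : 'rV[R]_n).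

Lemma flip_edge A B : edge A =2 edge B -> flip A =2 flip B.
Proof. by move=> AB k j; apply: eq_bigr => i _; rewrite AB. Qed.

Lemma bott_cover_edge A B x y : edge A =2 edge B ->
  bott_cover A x = bott_cover A y -> bott_cover B x = bott_cover B y.
Proof.
move=> AB /bott_coverP[k ->]; apply/bott_coverP; exists k.
by apply/rowP => j; rewrite !mxE (flip_edge AB).
Qed.

Lemma edge_lc v A i j :
  edge (local_complement v A) i j = edge A i j (+) (edge A i v && edge A v j).
Proof.
rewrite /edge mxE /edge.
by case: (ltnP i v) => iv; case: (ltnP v j) => vj; rewrite ?andbF ?addbF //= (ltn_trans iv).
Qed.

Lemma edge_lcK v A : edge (local_complement v (local_complement v A)) =2 edge A.
Proof.
move=> i j; have vv : edge A v v = false by rewrite /edge ltnn.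
by rewrite !edge_lc vv andbF addbF /= addbF -addbA addbb addbF.
Qed.

Lemma affine_equivalent_edge A B : edge A =2 edge B -> affine_equivalent R A B.
Proof.
move=> AB; exists 1%:M; first exact: unitmx1.
exists 0 => x y; rewrite /affine !mulmx1 !addr0.
by split; apply: bott_cover_edge => // i j; rewrite AB.
Qed.

(* Conjugating by the translation by [pi / 2] along the [v]-th coordinate
   turns a reflection of that coordinate into a reflection followed by a
   half-turn, that is, multiplies by [g_v] the generators reflecting it. *)
Lemma bott_cover_lc v A (b : bool) (t : 'rV[R]_n) :
  t = \row_j (if j == v then (-1) ^+ b * (pi / 2) else 0) -> forall x y,
  bott_cover A x = bott_cover A y ->
  bott_cover (local_complement v A) (x + t) =
  bott_cover (local_complement v A) (y + t).
Proof.
move=> tE x y /bott_coverP[k ->]; apply/bott_coverP.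
(* If [k] reflects coordinate [v], conjugation by [t] adds 2 t_v = (-1)^b pi to the shift, that is,
   (-1)^b lattice units. *)
pose k' : 'rV[int]_n :=
  \row_j (k 0 j + (if (j == v) && flip A k v then (-1) ^+ b else 0)).
have vv : edge A v v = false by rewrite /edge ltnn.
have parityk' i : parity k' 0 i = parity k 0 i + ((i == v) && flip A k v).
  by rewrite !mxE rmorphD /=; case: (_ && _) => //; case: (b).
(* The edges created or removed through [v] and the change of [k] at [v] both contribute
   [flip A k v * edge A v j], and cancel modulo 2. *)
have flipk' j : flip (local_complement v A) k' j = flip A k j.
  rewrite /flip (bigD1 v) //= parityk' eqxx /= edge_lc vv /= addbF.
  rewrite (eq_bigr (fun i => parity k 0 i * edge A i j +
     parity k 0 i * edge A i v * edge A v j)); last first.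
    move=> i iv; rewrite parityk' (negbTE iv) /= addr0 edge_lc.
    by rewrite -mulrA -mulrDr.
  rewrite big_split /= -mulr_suml mulrDl [RHS](bigD1 v) //= -!addrA.
  congr (_ + _); rewrite addrCA [flip A k v](bigD1 v) //= vv mulr0 add0r.
  rewrite -[RHS]addr0; congr (_ + _).
  by rewrite -mulrDl; case: (\sum_(_ < _ | _) _).
exists k'; apply/rowP => j; rewrite !mxE flipk' tE !mxE.
have [->|jv] := eqVneq j v; last by rewrite !addr0.
case: (flip A k v); rewrite /= ?expr0 ?expr1 ?mul1r ?mulN1r; last by rewrite addr0 addrAC.
rewrite rmorphD /= rmorphXn rmorphN1 /=; case: (b); rewrite ?expr0 ?expr1; lra.
Qed.

(** Translations by pi/2 and -pi/2 are mutually inverse and complementing twice at [v] restores the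
    edges, so the converse is [bott_cover_lc] with the opposite sign. *)
Lemma affine_equivalent_lc v A : affine_equivalent R A (local_complement v A).
Proof.
exists 1%:M; first exact: unitmx1.
pose t (b : bool) : 'rV[R]_n := \row_j (if j == v then (-1) ^+ b * (pi / 2) else 0).
have tK x : x + t false + t true = x.
  rewrite -addrA [_ + t true](_ : _ = 0) ?addr0 //; apply/rowP => j.
  by rewrite !mxE; case: eqP; rewrite ?addr0 // expr0 expr1 mul1r mulN1r subrr.
exists (t false) => x y; rewrite /affine !mulmx1.
split; first exact: (@bott_cover_lc _ _ false).
move/(@bott_cover_lc v _ true _ erefl); rewrite !tK.
exact/bott_cover_edge/edge_lcK.
Qed.

Lemma bott_cover_perm (s : 'S_n) A B :
  (forall i j, edge A i j = edge B (s i) (s j)) -> forall x y,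
  bott_cover A x = bott_cover A y ->
  bott_cover B (x *m perm_mx s) = bott_cover B (y *m perm_mx s).
Proof.
move=> AB x y /bott_coverP[k ->]; apply/bott_coverP.
have sE (z : 'rV[R]_n) : z *m perm_mx s = col_perm s^-1 z.
  by rewrite col_permE invgK.
exists (col_perm s^-1 k); rewrite !sE.
apply/rowP => j; rewrite !mxE; congr ((-1) ^+ (nat_of_bool _) * _ + _).
rewrite /flip [RHS](reindex_inj (@perm_inj _ s)); apply: eq_bigr => i _.
by rewrite AB permKV !mxE permK.
Qed.

Lemma affine_equivalent_perm (s : 'S_n) A B :
  (forall i j, edge A i j = edge B (s i) (s j)) -> affine_equivalent R A B.
Proof.
move=> AB; exists (perm_mx s); first exact: unitmx_perm.
exists 0 => x y; rewrite /affine !addr0; split; first exact: bott_cover_perm.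
have BA i j : edge B i j = edge A (s^-1%g i) (s^-1%g j) by rewrite AB !permKV.
by move/(bott_cover_perm BA); rewrite -!mulmxA -perm_mxM mulgV perm_mx1 !mulmx1.
Qed.

End Fixed.
End Moves.

(** * Lifting smooth maps to the universal cover *)

Section Lifting.
Variable R : realType.

Lemma coord_le_norm n (x : 'rV[R]_n) j : `|x 0 j| <= `|x|.
Proof.
rewrite [leRHS]/Num.norm /= mx_normrE; apply/bigmax_geP; right => /=.
by exists (0, j).
Qed.

Lemma deck_continuous n (A : 'M[bool]_n) k :
  continuous (deck A k : 'rV[R]_n -> 'rV[R]_n).
Proof.
move=> x; apply: (@rV_cvg _ _ (nbhs x)) => j; rewrite mxE.
under eq_fun do rewrite mxE.
apply: cvgD; last exact: cvg_cst.
by apply: cvgM; [exact: cvg_cst | exact: coord_continuous].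
Qed.

Section Fixed.
Variables (n : nat) (A B : 'M[bool]_n) (f : real_bott R A -> real_bott R B).
Implicit Types (D : set 'rV[R]_n) (G : 'rV[R]_n -> 'rV[R]_n) (a b x y : 'rV[R]_n).

Definition lift_on D G : Prop := {within D, continuous G} /\
  forall x, D x -> bott_cover B (G x) = f (bott_cover A x).

Lemma lift_on_sub D D' G : D' `<=` D -> lift_on D G -> lift_on D' G.
Proof.
move=> DD [cG fG]; split=> [|x /DD/fG //].
exact: continuous_subspaceW cG.
Qed.

Lemma lift_on_deck D G k : lift_on D G -> lift_on D (deck B k \o G).
Proof.
move=> [cG fG]; split=> [|x Dx /=]; last by rewrite bott_cover_deck fG.
by apply: within_continuous_comp => // y _; exact: deck_continuous.
Qed.

Lemma lift_on_eq D G G' : {in D, G =1 G'} -> lift_on D G -> lift_on D G'.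
Proof.
move=> GG [cG fG]; split=> [|x Dx]; last by rewrite -GG ?inE // fG.
exact: (subspace_eq_continuous GG).
Qed.

Lemma lift_local : smooth_map f ->
  forall x, exists2 r, 0 < r & exists G, lift_on (ball x r) G.
Proof.
move=> sf x; have [U [V [F [[[oU _] [x0 Ux0 x0E]] _ sF fF]]]] := sf (bott_cover A x).
(* The chart contains some [x0] in the fibre of [x], perhaps not [x] itself; [k] moves [x] to
   [x0]. *)
have [k kE] := (bott_coverP A x x0).1 (esym x0E).
pose D := deck A k @^-1` U.
have oD : open D by apply: open_comp oU => y _; exact: deck_continuous.
have Dx : D x by rewrite /D /= -kE.
have /nbhs_ballP[r /= r0 rD] := open_nbhs_nbhs (conj oD Dx).
exists r => //; exists (F \o deck A k); split=> [|y yr /=]; last first.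
  by rewrite -fF ?bott_cover_deck //; exact: rD.
apply: continuous_in_subspaceT => y; rewrite inE => yr.
apply: continuous_comp; first exact: deck_continuous.
exact: (sF 0%N _ (rD _ yr)).
Qed.

Definition convex_set D := forall x y, D x -> D y ->
  forall t, 0 <= t <= 1 -> D (x + t *: (y - x)).

(** Along the segment from x to y the distance between the lifts is continuous, and it is 0 or
    exceeds 1 because distinct points of a fibre are pi apart. The intermediate value theorem
    excludes a jump past 1. *)
Lemma lift_unique D G G' : convex_set D -> lift_on D G -> lift_on D G' ->
  forall x y, D x -> D y -> G x = G' x -> G y = G' y.
Proof.
move=> cD [cG fG] [cG' fG'] x y Dx Dy GG'.
pose p t := x + t *: (y - x).
have sep z : D z -> G z != G' z -> 1 < `|G z - G' z|.
  move=> Dz Gz; have [j] := bott_cover_sep (etrans (fG z Dz) (esym (fG' z Dz))) Gz.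
  have := coord_le_norm (G z - G' z) j; rewrite !mxE; have := pi_ge2 R; lra.
have pD t : `[0, 1]%classic t -> D (p t) by rewrite /= in_itv; exact: cD.
have p0 : p 0 = x by rewrite /p scale0r addr0.
have p1 : p 1 = y by rewrite /p scale1r addrC subrK.
have cp : continuous p.
  move=> t; apply: cvgD; first exact: cvg_cst.
  by apply: cvgZ; [exact: cvg_id | exact: cvg_cst].
have cpG (H : 'rV[R]_n -> 'rV[R]_n) : {within D, continuous H} ->
    {within `[0, 1]%classic, continuous (H \o p)}.
  move=> cH; apply/subspace_continuousP => t t01.
  move: cH => /subspace_continuousP cH.
  apply: (cvg_trans _ (cH _ (pD _ t01))) => U HU.
  have : \forall s \near t, D (p s) -> U (H (p s)) := cp t _ HU.
  by apply: filterS => s sP /pD; exact: sP.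
apply/eqP; apply: contraT => Gy.
have [||c c01 /= pc1] := @IVT R (fun t => `|G (p t) - G' (p t)|) 0 1 1 ler01.
- move=> t; apply: cvg_norm.
  exact: (within_continuousB (cpG _ cG) (cpG _ cG')).
- rewrite p0 p1 GG' subrr normr0.
  by rewrite ge_min ler01 le_max (ltW (sep _ Dy Gy)) orbT.
have [Gc|Gc] := eqVneq (G (p c)) (G' (p c)).
  by move: pc1; rewrite Gc subrr normr0; lra.
by have := sep _ (pD _ c01) Gc; lra.
Qed.

Definition box a b : set 'rV[R]_n := [set x | forall j, a 0 j <= x 0 j <= b 0 j].

Lemma convex_box a b : convex_set (box a b).
Proof.
move=> x y xab yab t t01 j; rewrite !mxE.
by have := xab j; have := yab j; nra.
Qed.

Lemma compact_box a b : compact (box a b).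
Proof.
have := @rV_compact R n (fun j => `[a 0 j, b 0 j]%classic)
  (fun j => @segment_compact R (a 0 j) (b 0 j)).
rewrite [X in compact X](_ : _ = box a b) //.
Qed.

Lemma closed_box a b : closed (box a b).
Proof. by apply: compact_closed (@compact_box a b); exact: norm_hausdorff. Qed.

(** A Lebesgue number: a lift on the ball of radius r at x restricts to every ball of radius below
    r/2 centred within r/2 of x, and compactness makes this uniform. *)
Lemma lift_lebesgue (K : set 'rV[R]_n) : smooth_map f -> compact K ->
  exists2 d, 0 < d & forall x, K x -> exists G, lift_on (ball x d) G.
Proof.
move=> sf /compact_near_coveringP cK.
have : \forall d \near 0^'+, K `<=` (fun x => exists G, lift_on (ball x d) G).
  apply: cK => x _; have [r r0 [G lG]] := lift_local sf x.
  have r2 : 0 < r / 2 by rewrite divr_gt0.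
  exists (ball x (r / 2), [set d | d < r / 2]); first split.
  - exact: nbhsx_ballx.
  - exact: nbhs_right_lt.
  move=> [y d] /= [xy dr]; exists G; apply: lift_on_sub lG => z yz.
  rewrite (splitr r); apply: ball_triangle xy _.
  by apply: le_ball yz; exact: ltW.
move=> Kd; near (0:R)^'+ => d; exists d; first by [].
by near: d.
Unshelve. all: by end_near.
Qed.

Definition upd a j c : 'rV[R]_n := \row_i if i == j then c else a 0 i.

(** At the common point [p] the two lifts differ by a deck transformation; after correcting [G2] by
    it they agree on the whole convex intersection, by [lift_unique], and glue along closed sets. *)
Lemma lift_paste a b j c : (forall i, a 0 i <= b 0 i) -> a 0 j <= c <= b 0 j ->
  (exists G, lift_on (box a (upd b j c)) G) ->
  (exists G, lift_on (box (upd a j c) b) G) ->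
  exists G, lift_on (box a b) G.
Proof.
move=> ab acb [G1 l1] [G2 l2].
set D1 := box _ _ in l1; set D2 := box _ _ in l2.
have D1E x : D1 x <-> box a b x /\ x 0 j <= c.
  split=> [xD|[xab xc] i]; last first.
    by rewrite mxE; case: eqP => [->|_]; [have := xab j; lra | exact: xab].
  split=> [i|]; last by have := xD j; rewrite mxE eqxx; lra.
  by have := xD i; rewrite mxE; case: eqP => [->|_]; lra.
have D2E x : D2 x <-> box a b x /\ c <= x 0 j.
  split=> [xD|[xab xc] i]; last first.
    by rewrite mxE; case: eqP => [->|_]; [have := xab j; lra | exact: xab].
  split=> [i|]; last by have := xD j; rewrite mxE eqxx; lra.
  by have := xD i; rewrite mxE; case: eqP => [->|_]; lra.
pose p := upd a j c.
have pab : box a b p.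
  by move=> i; rewrite mxE; case: eqP => [->|_] //; rewrite lexx ab.
have D1p : D1 p by apply/D1E; rewrite mxE eqxx lexx.
have D2p : D2 p by apply/D2E; rewrite mxE eqxx lexx.
have /bott_coverP[k kE] : bott_cover B (G2 p) = bott_cover B (G1 p).
  by rewrite l1.2 // l2.2.
have G12 x : D1 x -> D2 x -> G1 x = deck B k (G2 x).
  move=> D1x D2x; apply: (@lift_unique (D1 `&` D2) _ (deck B k \o G2))
    (conj D1p D2p) _ _ => //.
  - move=> y z [D1y D2y] [D1z D2z] t t01.
    by split; exact: convex_box.
  - by apply: lift_on_sub l1 => y [].
  - by apply: lift_on_deck; apply: lift_on_sub l2 => y [].
pose G x := if x 0 j <= c then G1 x else deck B k (G2 x).
have l1' : lift_on D1 G.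
  by apply: lift_on_eq l1 => x; rewrite inE /G => /D1E[_ ->].
have l2' : lift_on D2 G.
  apply: lift_on_eq (lift_on_deck k l2) => x; rewrite inE /G => D2x /=.
  case: ifP => // xc; rewrite G12 //; apply/D1E; split=> //.
  by have /D2E[] := D2x.
have D12 : box a b `<=` D1 `|` D2.
  by move=> x xab; have [xc|/ltW xc] := leP (x 0 j) c; [left; apply/D1E|right; apply/D2E].
exists G; split=> [|x /D12[D1x|D2x]]; [|exact: l1'.2|exact: l2'.2].
apply: continuous_subspaceW D12 _.
by apply: withinU_continuous; [exact: closed_box..|exact: l1'.1|exact: l2'.1].
Qed.

Lemma lift_box a b : smooth_map f -> (forall i, a 0 i <= b 0 i) ->
  exists G, lift_on (box a b) G.
Proof.
move=> sf; have [d d0 dP] := lift_lebesgue sf (@compact_box a b).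
(* Halving a side of length at least [d] removes at least [d / 2] from the sum
   of the sides; once all sides are shorter than [d], a local lift is enough. *)
have ind (M : nat) a' b' : box a' b' `<=` box a b ->
    (forall i, a' 0 i <= b' 0 i) -> \sum_i (b' 0 i - a' 0 i) <= M%:R * (d / 2) ->
    exists G, lift_on (box a' b') G.
  have wE (u v u' v' : 'rV[R]_n) (j : 'I_n) :
      (forall i, i != j -> u' 0 i = u 0 i) -> (forall i, i != j -> v' 0 i = v 0 i) ->
      \sum_i (v' 0 i - u' 0 i) =
      \sum_i (v 0 i - u 0 i) + ((v' 0 j - u' 0 j) - (v 0 j - u 0 j)).
    move=> uu vv; rewrite (bigD1 j) //= [in RHS](bigD1 j) //=.
    rewrite (eq_bigr (fun i => v 0 i - u 0 i)) => [|i ij]; first by ring.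
    by rewrite uu // vv.
  have small u v : box u v `<=` box a b -> (forall i, u 0 i <= v 0 i) ->
      (exists G, lift_on (box u v) G) \/ exists j, d <= v 0 j - u 0 j.
    move=> uvab uv.
    have [/existsP[j wj]|/existsPn small] := boolP [exists j, d <= v 0 j - u 0 j].
      by right; exists j.
    left; have [|G lG] := dP u; first by apply: uvab => i; rewrite lexx uv.
    exists G; apply: lift_on_sub lG => x xuv; split=> // i j.
    rewrite /ball /= ord1; have := small j; rewrite -ltNge.
    by have := xuv j; move=> ? ?; rewrite ltr_norml; lra.
  elim: M a' b' => [|M IHM] a' b' bab ab' wM.
    have [//|[j wj]] := small _ _ bab ab'.
    have : 0 <= \sum_(i | i != j) (b' 0 i - a' 0 i).
      by apply: sumr_ge0 => i _; rewrite subr_ge0.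
    by move: wM; rewrite (bigD1 j) //= mul0r; lra.
  have [//|[j wj]] := small _ _ bab ab'.
  pose c := (a' 0 j + b' 0 j) / 2.
  have sub_le (u v : 'rV[R]_n) : (forall i, a' 0 i <= u 0 i) -> (forall i, v 0 i <= b' 0 i) ->
      box u v `<=` box a b.
    move=> au vb x xuv; apply: bab => i.
    by have := au i; have := vb i; have := xuv i; lra.
  apply: (@lift_paste _ _ j c) => //; first by rewrite /c; lra.
  - apply: IHM.
    + by apply: sub_le => // i; rewrite mxE; case: eqP => // ->; rewrite /c; lra.
    + by move=> i; rewrite mxE; case: eqP => // ->; rewrite /c; lra.
    + rewrite (wE a' b' _ _ j) => // [|i ij]; last by rewrite mxE (negbTE ij).
      by rewrite mxE eqxx /c; move: wM; rewrite -natr1 mulrDl; lra.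
  - apply: IHM.
    + by apply: sub_le => // i; rewrite mxE; case: eqP => // ->; rewrite /c; lra.
    + by move=> i; rewrite mxE; case: eqP => // ->; rewrite /c; lra.
    + rewrite (wE a' b' _ _ j) => // [|i ij]; last by rewrite mxE (negbTE ij).
      by rewrite mxE eqxx /c; move: wM; rewrite -natr1 mulrDl; lra.
move=> ab; pose w := \sum_i (b 0 i - a 0 i) / (d / 2).
apply: (ind (Num.bound w)) => //; rewrite -ler_pdivrMr ?divr_gt0 // mulr_suml.
apply/ltW/archi_boundP/sumr_ge0 => i _; rewrite divr_ge0 ?subr_ge0 //.
by rewrite divr_ge0 // ltW.
Qed.

Definition cube (N : nat) := box (const_mx (- N%:R)) (const_mx N%:R).

Lemma cubeP N x : cube N x <-> forall j, `|x 0 j| <= N%:R.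
Proof.
by split=> h j; have := h j; rewrite ?mxE ler_norml.
Qed.

(** Lifts on growing cubes, normalised to the same value at 0, agree by uniqueness. Continuity at x
    is that of the lift on a cube containing the unit ball at x. *)
Lemma smooth_map_lift : smooth_map f ->
  exists2 G, continuous G & forall x, bott_cover B (G x) = f (bott_cover A x).
Proof.
move=> sf; have [y0 y0E] := bott_cover_surj (f (bott_cover A 0)).
have cube0 N : cube N 0 by apply/cubeP => j; rewrite mxE normr0.
have /choice[g gP] N : exists G, lift_on (cube N) G /\ G 0 = y0.
  have [|G lG] := @lift_box (const_mx (- N%:R)) (const_mx N%:R) sf.
    by move=> i; rewrite !mxE; have := ler0n R N; lra.
  have /bott_coverP[k kE] : bott_cover B (G 0) = bott_cover B y0.
    by rewrite y0E lG.2 //; exact: cube0.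
  by exists (deck B k \o G); split; first exact: lift_on_deck.
have gE N M x : (N <= M)%N -> cube N x -> g N x = g M x.
  move=> NM Nx; have [lN g0N] := gP N; have [lM g0M] := gP M.
  apply: (@lift_unique (cube N) _ (g M) _ lN _ 0 x) => //.
  - exact: convex_box.
  - apply: lift_on_sub lM => y /cubeP Ny; apply/cubeP => j.
    by apply: le_trans (Ny j) _; rewrite ler_nat.
  - by rewrite g0N.
pose G x := g (Num.bound `|x|) x.
have boundx x : cube (Num.bound `|x|) x.
  apply/cubeP => j; apply: le_trans (coord_le_norm x j) _.
  exact/ltW/archi_boundP.
have GE N x : cube N x -> G x = g N x.
  move=> Nx; have [NM|/ltnW MN] := leqP N (Num.bound `|x|).
    by rewrite (gE _ _ _ NM).
  exact: gE.
exists G => [x|x]; last by have [[_ ->]] := gP (Num.bound `|x|).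
pose M := (Num.bound `|x|).+1.
have ballM y : ball x 1 y -> cube M y.
  move=> [_ xy]; apply/cubeP => j; have /cubeP/(_ j) := boundx x.
  have := xy 0 j; rewrite /ball /= /M -natr1; have := ler_normB (x 0 j) (x 0 j - y 0 j).
  rewrite opprB addrC subrK; lra.
have nM : nbhs x (cube M).
  by apply: filterS ballM _; exact: nbhsx_ballx.
have cg : g M y @[y --> x] --> g M x.
  by rewrite (nbhs_subspace_interior nM); exact: (gP M).1.1.
rewrite /continuous_at (GE M); last exact: nbhs_singleton nM.
apply: cvg_trans cg; apply: (@near_eq_cvg _ _ (nbhs x)).
by apply: filterS nM => y /GE ->.
Qed.

End Fixed.
End Lifting.

(** * The isomorphism of deck groups modulo 2 *)

Section ParityIso.
Variable n : nat.
Implicit Types A B C : 'M[bool]_n.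

(* A homomorphism of fundamental groups inducing an isomorphism, of matrix [P],
   on [H_1(-; Z/2)]. *)
Definition parity_iso A B : Prop :=
  exists2 phi : 'rV[int]_n -> 'rV[int]_n,
    forall k l, phi (deck_mul A k l) = deck_mul B (phi k) (phi l)
  & exists2 P : 'M[bool]_n, P \in unitmx
  & forall k, parity (phi k) = parity k *m P.

Lemma parity_iso_trans A B C : parity_iso A B -> parity_iso B C -> parity_iso A C.
Proof.
move=> [f fM [P Pu fP]] [g gM [Q Qu gQ]]; exists (g \o f) => [k l /=|].
  by rewrite fM gM.
exists (P *m Q) => [|k /=]; first by rewrite unitmx_mul Pu.
by rewrite gQ fP mulmxA.
Qed.

Lemma parity_homP A B (phi : 'rV[int]_n -> 'rV[int]_n) :
  (forall k l, phi (deck_mul A k l) = deck_mul B (phi k) (phi l)) ->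
  exists P : 'M[bool]_n, forall k, parity (phi k) = parity k *m P.
Proof.
move=> phiM; exists (\matrix_i parity (phi (delta_mx 0 i))).
set P := \matrix_i _; apply: (deck_ind (A := A)) => [|i k].
  have := phiM 0 0; rewrite mul0_deck => /(congr1 (@parity n)).
  rewrite parity_mul => /eqP; rewrite -subr_eq subrr eq_sym => /eqP ->.
  by rewrite parity0 mul0mx.
rewrite phiM !parity_mul mulmxDl parity_delta -rowE rowK.
by split=> [/addrI|->].
Qed.

(** Here [w i] is the sign exponent of phi(e_i) in coordinate j. Applying phi to the relation
    between e_i and e_l and reading off coordinate j gives an integer equation; according to the two
    signs it says a = b, a = 0, b = 0 or nothing, which is reduced modulo 2. *)
Lemma parity_relation A B (phi : 'rV[int]_n -> 'rV[int]_n) (P : 'M[bool]_n) :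
  (forall k l, phi (deck_mul B k l) = deck_mul A (phi k) (phi l)) ->
  (forall k, parity (phi k) = parity k *m P) ->
  forall j (i l : 'I_n), (i < l)%N ->
  let w i := \sum_r P i r * edge A r j in
  P i j * w l + P l j * w i = edge B i l * (P l j * (1 + w l)).
Proof.
move=> phiM phiP j i l il w.
have wE r : w r = flip A (phi (delta_mx 0 r)) j.
  by rewrite /flip phiP parity_delta -rowE; apply: eq_bigr => s _; rewrite mxE.
have PE r : P r j = (phi (delta_mx 0 r) 0 j)%:~R.
  have := phiP (delta_mx 0 r); rewrite parity_delta -rowE.
  by move/rowP/(_ j); rewrite !mxE.
rewrite !wE !PE; case E : (edge B i l).
  have /rowP/(_ j) := congr1 phi (deck_flip E); rewrite !phiM !mxE.
  set a := phi (delta_mx 0 i) 0 j; set b := phi (delta_mx 0 l) 0 j.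
  case: (flip A _ j); case: (flip A _ j); rewrite ?expr0 ?expr1 => h.
  - have -> : a = b by lia.
    by case: (b%:~R).
  - have -> : a = 0 by lia.
    by case: (b%:~R).
  - by case: (b%:~R); case: (a%:~R).
  - have -> : b = 0 by lia.
    by case: (a%:~R).
have /rowP/(_ j) := congr1 phi (deck_comm il E); rewrite !phiM !mxE.
set a := phi (delta_mx 0 i) 0 j; set b := phi (delta_mx 0 l) 0 j.
rewrite mul0r.
case: (flip A _ j); case: (flip A _ j); rewrite ?expr0 ?expr1 => h.
- have -> : a = b by lia.
  by case: (b%:~R).
- have -> : b = 0 by lia.
  by case: (a%:~R).
- have -> : a = 0 by lia.
  by case: (b%:~R).
- by case: (b%:~R); case: (a%:~R).
Qed.

End ParityIso.

(** * The isomorphism induced by a diffeomorphism *)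

Section FundamentalGroup.
Variables (R : realType) (n : nat).
Implicit Types A B : 'M[bool]_n.

Lemma lift_on_setT A B (f : real_bott R A -> real_bott R B) F :
  continuous F -> (forall x, bott_cover B (F x) = f (bott_cover A x)) ->
  lift_on f setT F.
Proof. by move=> cF fF; split=> // x; apply: continuous_subspaceT. Qed.

Lemma lift_eq A B (f : real_bott R A -> real_bott R B) F G :
  continuous F -> (forall x, bott_cover B (F x) = f (bott_cover A x)) ->
  continuous G -> (forall x, bott_cover B (G x) = f (bott_cover A x)) ->
  F 0 = G 0 -> F =1 G.
Proof.
move=> cF fF cG fG FG x.
apply: (lift_unique _ (lift_on_setT cF fF) (lift_on_setT cG fG) (x := 0)) => //.
Qed.

(** F after a deck transformation lifts f composed with the covering as well, so it is a deck
    transformation after F, by agreement at 0 and uniqueness. Freeness of the action makes phi a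
    homomorphism. *)
Lemma lift_deck A B (f : real_bott R A -> real_bott R B) F :
  continuous F -> (forall x, bott_cover B (F x) = f (bott_cover A x)) ->
  exists2 phi, forall k l, phi (deck_mul A k l) = deck_mul B (phi k) (phi l)
  & forall k x, F (deck A k x) = deck B (phi k) (F x).
Proof.
move=> cF fF.
have /choice[phi phiP] k : exists k', forall x, F (deck A k x) = deck B k' (F x).
  have /bott_coverP[k' k'E] : bott_cover B (F 0) = bott_cover B (F (deck A k 0)).
    by rewrite !fF bott_cover_deck.
  exists k'; apply: (@lift_eq A B f) => //.
  - by move=> x; apply: continuous_comp; [exact: deck_continuous | exact: cF].
  - by move=> x; rewrite fF bott_cover_deck.
  - by move=> x; apply: continuous_comp; [exact: cF | exact: deck_continuous].
  - by move=> x; rewrite bott_cover_deck fF.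
exists phi => // k l; apply: (@deck_inj _ B R _ _ (F 0)).
by rewrite -phiP !deckM !phiP.
Qed.

(** The composite of the lifts of f and g lifts the identity, so it is a deck transformation [d].
    Hence psi after phi is conjugation by [d], which is trivial modulo 2, and P Q = 1. *)
Lemma diffeomorphic_parity_iso A B : diffeomorphic R A B -> parity_iso A B.
Proof.
move=> [f [g [fK gK sf sg]]].
have [F cF fF] := smooth_map_lift sf; have [G cG gG] := smooth_map_lift sg.
have [phi phiM phiF] := lift_deck cF fF; have [psi psiM psiG] := lift_deck cG gG.
have [P phiP] := parity_homP phiM; have [Q psiQ] := parity_homP psiM.
exists phi => //; exists P => //.
have GF x : bott_cover A (G (F x)) = id (bott_cover A x) by rewrite gG fF fK.
have [d dE] := (bott_coverP A 0 (G (F 0))).1 (esym (GF 0)).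
have GFE x : G (F x) = deck A d x.
  apply: (@lift_eq A A id (G \o F)) => //.
  - by move=> y; apply: continuous_comp; [exact: cF | exact: cG].
  - exact: deck_continuous.
  - by move=> y; rewrite bott_cover_deck.
have PQ k : parity k = parity k *m (P *m Q).
  have /(congr1 (@parity n)) : deck_mul A d k = deck_mul A (psi (phi k)) d.
    apply: (@deck_inj _ A R _ _ 0).
    by rewrite !deckM -!GFE phiF psiG.
  by rewrite !parity_mul psiQ phiP [LHS]addrC mulmxA => /addIr.
suff /mulmx1_unit[] : P *m Q = 1%:M by [].
apply/row_matrixP => i; rewrite !rowE -[in LHS]parity_delta -PQ parity_delta.
by rewrite mulmx1.
Qed.

End FundamentalGroup.

(** * Rigidity of the normal form *)

Section NormalForm.

(* The vertices are a path [0 -> 1 -> ... -> m] and sinks [m + 1, ...] all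
   receiving an edge from [m]; the only other edges are [0 -> j] for [c j]. *)
Definition normal_edge (m : nat) (c : nat -> bool) (i j : nat) : bool :=
  (0 < j)%N && ((i == minn j.-1 m) || (i == 0) && c j).

Definition normal_form n m (c : nat -> bool) : 'M[bool]_n :=
  \matrix_(i, j) ((i == j) || normal_edge m c i j).

Lemma normal_formE n m c (i j : 'I_n) :
  normal_form n m c i j = (i == j) || normal_edge m c i j.
Proof. by rewrite mxE. Qed.

Lemma edge_normal n m c (i j : 'I_n) :
  edge (normal_form n m c) i j = normal_edge m c i j.
Proof.
rewrite /edge mxE -val_eqE /normal_edge /=.
case: (ltnP i j) => [ij|ji] /=; first by rewrite ltn_eqF //.
by move: (c j) => b; lia.
Qed.

Lemma minn_pred_lt l m t : (0 < l)%N -> (t < m)%N -> minn l.-1 m = t -> l = t.+1.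
Proof. lia. Qed.

Section Rigidity.
Variables (n m : nat) (c c' : nat -> bool) (P : 'M[bool]_n.+1).
Hypotheses (m2 : (2 <= m)%N) (mn : (m < n)%N).
Hypotheses (c1 : c 1%N = false) (c2 : c 2%N = false).
Hypotheses (c'1 : c' 1%N = false) (c'2 : c' 2%N = false).
Hypothesis Pu : P \in unitmx.

Let A : 'M[bool]_n.+1 := normal_form n.+1 m c.
Let B : 'M[bool]_n.+1 := normal_form n.+1 m c'.
Let w i j := \sum_r P i r * edge A r j.

Hypothesis relP : forall j (i l : 'I_n.+1), (i < l)%N ->
  P i j * w l j + P l j * w i j = edge B i l * (P l j * (1 + w l j)).

Let edgeB (i j : 'I_n.+1) : edge B i j = normal_edge m c' i j.
Proof. exact: edge_normal. Qed.

(** [t] is the predecessor of [s] on the path, or [m] if [s] is a sink. The possible sources [t] and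
    0 coincide only for s = 1, where [c1] removes the second, so the disjunction of edges is a sum
    modulo 2. *)
Let wE i (s t : 'I_n.+1) : (0 < s)%N -> minn s.-1 m = t ->
  w i s = P i t + c s * P i 0.
Proof.
move=> s0 st; have cs : t = 0 -> c s = false.
  move=> t0; suff -> : s = 1%N :> nat by [].
  by move: st; rewrite t0 /=; lia.
rewrite /w (eq_bigr (fun r => P i r * (r == t) + P i r * ((r == 0) * c s))).
  rewrite big_split /=; congr (_ + _).
    rewrite (bigD1 t) //= eqxx mulr1 big1 ?addr0 // => r /negbTE ->.
    by rewrite mulr0.
  rewrite (bigD1 0) //= eqxx mul1r big1 => [|r /negbTE ->].
    by rewrite addr0 [RHS]mulrC.
  by rewrite mul0r mulr0.
move=> r _; rewrite -mulrDr edge_normal /normal_edge s0 st -!val_eqE /=.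
congr (_ * _); have [rt|_] := eqVneq (r : nat) t; last by rewrite add0r.
have [r0|_] := eqVneq (r : nat) 0; last by rewrite mul0r.
by rewrite cs //; apply: val_inj; exact: etrans (esym rt) r0.
Qed.

(** The invariant of an induction along the path. Column [d] is known only up to adding the
    in-neighbours of [d]; the bit [e] is settled by [step] at the next vertex. *)
Let claim d := [/\
  forall i j : 'I_n.+1, (j < d)%N -> P i j = (i == j),
  forall j : 'I_n.+1, (0 < j <= d)%N -> c j = c' j
& forall j : 'I_n.+1, j = d :> nat ->
    exists e : bool, forall i, P i j = (i == j) + e * edge B i j].

(** Column s of P would be a combination of the earlier columns t and 0, and [v] would be a nonzero
    kernel vector. *)
Let independent (s t : 'I_n.+1) (a b : bool) : (t < s)%N ->
  (forall i, P i s = a * (P i t + b * P i 0)) -> False.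
Proof.
move=> ts Ps.
pose v : 'cV[bool]_n.+1 := \col_j ((j == s) + a * ((j == t) + b * (j == 0))).
have Pv : P *m v = 0.
  apply/colP => i; rewrite !mxE.
  rewrite (eq_bigr (fun j => P i j * (j == s) + a * (P i j * (j == t)) +
    a * (b * (P i j * (j == 0))))); last first.
    by move=> j _; rewrite !mxE; case: (P i j); case: a {Ps v}; case: b => //=;
      rewrite ?mulr1 ?mul1r ?mul0r ?mulr0 ?addr0 ?addrA.
  rewrite !big_split /= -!mulr_sumr.
  have delta j : \sum_j0 P i j0 * (j0 == j) = P i j.
    by rewrite (bigD1 j) //= eqxx mulr1 big1 ?addr0 // => r /negbTE ->; rewrite mulr0.
  by rewrite !delta Ps; case: (a); case: (b); case: (P i t); case: (P i 0).
have : v = 0 by rewrite -[v](mulKmx Pu) Pv mulmx0.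
move/colP/(_ s); rewrite !mxE eqxx -!val_eqE /= gtn_eqF // gtn_eqF ?(leq_ltn_trans _ ts) //.
by rewrite mulr0 addr0 mulr0 addr0.
Qed.

(** In column [s], w is 1 at [t] and 0 below it. So the relations for pairs (i, t) give [low], and
    those for (i, l) with t < l and P l s = 1 identify w with column l of B ([high]). Such an l
    exists by [independent]. *)
Let step d (s t : 'I_n.+1) : claim d -> (d <= m)%N -> t = d :> nat ->
  (t < s)%N -> minn s.-1 m = t ->
  [/\ forall i, P i t = (i == t),
      forall i : 'I_n.+1, (i < t)%N -> P i s = P t s * w i s,
      exists2 l : 'I_n.+1, (t < l)%N & P l s
    & forall l : 'I_n.+1, (t < l)%N -> P l s ->
        [/\ minn l.-1 m = t, c s = c' l &
            forall i : 'I_n.+1, (i < l)%N -> w i s = edge B i l]].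
Proof.
move=> [P1 P2 /(_ t) P3] dm td ts st; have [e eP] := P3 td.
have s0 : (0 < s)%N by exact: leq_ltn_trans ts.
have cs0 : t = 0 -> c s = false.
  move=> t0; suff -> : s = 1%N :> nat by [].
  by move: st; rewrite t0 /=; lia.
have ws i : w i s = (i == t) + e * edge B i t + c s * (i == 0).
  rewrite (wE i s0 st) eP; congr (_ + _).
  have [t0|t0] := eqVneq t 0; first by rewrite cs0 // !mul0r.
  by rewrite P1 // -td lt0n.
have Btt : edge B t t = false by rewrite /edge ltnn.
have wt : w t s = true.
  rewrite ws eqxx Btt mulr0 addr0; have [t0|t0] := eqVneq t 0.
    by rewrite cs0 // mul0r addr0.
  by rewrite mulr0 addr0.
have wl (l : 'I_n.+1) : (t < l)%N -> w l s = false.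
  move=> tl; rewrite ws /edge ltnNge (ltnW tl) /= mulr0 -!val_eqE /=.
  by rewrite gtn_eqF // gtn_eqF ?(leq_ltn_trans _ tl) // mulr0.
have low (i : 'I_n.+1) : (i < t)%N -> P i s = P t s * w i s.
  by move=> /(@relP s); rewrite wt; case: (P i s); case: (P t s);
    case: (w i s); case: (edge B i t).
have high (l : 'I_n.+1) : (t < l)%N -> P l s ->
    forall i : 'I_n.+1, (i < l)%N -> w i s = edge B i l.
  move=> tl Pls i /(@relP s); rewrite (wl _ tl) Pls.
  by case: (P i s); case: (w i s); case: (edge B i l).
(* By [high], both [t] and the predecessor of [l] have an edge to [l] in B. If they differ, then t =
   0, and [ws] makes w vanish at that predecessor, a contradiction. *)
have prl (l : 'I_n.+1) : (t < l)%N -> P l s -> minn l.-1 m = t.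
  move=> tl Pls; have l0 : (0 < l)%N by exact: leq_ltn_trans tl.
  have pl : (minn l.-1 m < n.+1)%N by rewrite ltnS geq_min (ltnW mn) orbT.
  have ll : (minn l.-1 m < l)%N by rewrite gtn_min ltn_predL l0.
  have : edge B (Ordinal pl) l by rewrite edgeB /normal_edge l0 eqxx.
  rewrite -(high _ tl Pls) // ws.
  have [/(congr1 val) //|pt] := eqVneq (Ordinal pl) t.
  have := high _ tl Pls t tl; rewrite wt edgeB /normal_edge l0 /= eq_sym.
  have := pt; rewrite -val_eqE /= => /negbTE -> /= /esym/andP[/eqP t0 _].
  have t00 : t = 0 by exact: val_inj.
  by rewrite t00 cs0 // mul0r addr0 /edge ltn0 mulr0.
have [l tl Pls] : exists2 l : 'I_n.+1, (t < l)%N & P l s.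
  have [/existsP[l /andP[tl Pls]]|/existsPn Pn] :=
    boolP [exists l : 'I_n.+1, (t < l)%N && P l s].
    by exists l.
  exfalso; apply: (@independent s t (P t s) (c s) ts) => i; rewrite -(wE i s0 st).
  case: (ltngtP i t) => [/low //|ti|it]; last first.
    by rewrite (val_inj it) wt mulr1.
  by rewrite (wl _ ti) mulr0; apply/negbTE; have := Pn i; rewrite ti.
(* Compare w with column l of B in row t - 1. For t = 1 both [s] and [l] are 2, and the
   normalisation [c2], [c'2] is what forces e = 0. *)
have e0 i : e * edge B i t = false.
  have [t0|t0] := posnP t; first by rewrite /edge t0 ltn0 mulr0.
  have tm : (t.-1 < n.+1)%N by exact: leq_ltn_trans (leq_pred t) _.
  have Bt' : edge B (Ordinal tm) t = true.
    by rewrite edgeB /normal_edge t0 /=; by move: t0 dm; rewrite -td; clear; lia.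
  have t'l : (t.-1 < l)%N by exact: leq_ltn_trans (leq_pred t) tl.
  have := high _ tl Pls (Ordinal tm) t'l; rewrite ws Bt' edgeB /normal_edge.
  rewrite (prl _ tl Pls) -!val_eqE /= [X in X || _]ltn_eqF ?ltn_predL //.
  rewrite ltn_eqF ?ltn_predL //= add0r mulr1.
  have [t1|t1] := eqVneq (t : nat) 1%N.
    have tm' : (t < m)%N by rewrite t1.
    have l0 : (0 < l)%N by exact: leq_ltn_trans tl.
    have -> : l = 2%N :> nat by rewrite (minn_pred_lt l0 tm' (prl _ tl Pls)) t1.
    have -> : s = 2%N :> nat by rewrite (minn_pred_lt s0 tm' st) t1.
    by rewrite c2 c'2 mul0r addr0 andbF => ->; rewrite mul0r.
  have -> : (t.-1 == 0)%N = false by move: t0 t1; clear; lia.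
  by rewrite mulr0 addr0 andbF => ->; rewrite mul0r.
split=> //; [by move=> i; rewrite eP e0 addr0 | by exists l |].
move=> l' tl' Pl's; split; [exact: prl | | exact: high].
have l'0 : (0 < l')%N by exact: leq_ltn_trans tl'.
have [t0|t0] := posnP t.
  have tm : (t < m)%N by rewrite t0 ltnW.
  have -> : l' = 1%N :> nat by rewrite (minn_pred_lt l'0 tm (prl _ tl' Pl's)) t0.
  have -> : s = 1%N :> nat by rewrite (minn_pred_lt s0 tm st) t0.
  by rewrite c1 c'1.
have := high _ tl' Pl's 0 l'0; rewrite ws e0 edgeB /normal_edge (prl _ tl' Pl's) l'0.
by rewrite -!val_eqE /= ltn_eqF //= mulr1.
Qed.

Let claimP d : (d <= m)%N -> claim d.
Proof.
elim: d => [_|d IHd dm].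
  split=> [//|j|j j0]; first by case: (j : nat).
  have {j0} -> : j = 0 by exact: val_inj.
  exists false => i; rewrite mul0r addr0.
  (* No edge enters 0, so w vanishes there, and the relation between l > 0 and its predecessor reads
     P l 0 = 0. *)
  have w0 l : w l 0 = false.
    by rewrite /w big1 // => r _; rewrite /edge ltn0 mulr0.
  have Pl (l : 'I_n.+1) : (0 < l)%N -> P l 0 = false.
    move=> l0; have pl : (minn l.-1 m < n.+1)%N by rewrite ltnS geq_min (ltnW mn) orbT.
    have ll : (minn l.-1 m < l)%N by rewrite gtn_min ltn_predL l0.
    have := @relP 0 (Ordinal pl) l ll; rewrite !w0 edgeB /normal_edge l0 eqxx /=.
    by rewrite mul1r; case: (P l 0); rewrite !mulr0.
  have [->|i0] := eqVneq i 0; last by apply: Pl; rewrite lt0n.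
  apply/negPn/negP => /negbTE P00.
  have : col 0 P = 0.
    apply/colP => l; rewrite !mxE; have [->//|l0] := eqVneq l 0.
    by apply: Pl; rewrite lt0n.
  move/(congr1 (mulmx (invmx P))); rewrite colE mulKmx // mulmx0.
  by move/colP/(_ 0); rewrite !mxE.
have cd := IHd (ltnW dm); have dn : (d < n.+1)%N by rewrite ltnS (leq_trans (ltnW dm)) // ltnW.
have [P1 P2 _] := cd; pose t := Ordinal dn.
have H (s : 'I_n.+1) : s = d.+1 :> nat -> _ := fun sd =>
  @step d s t cd (ltnW dm) erefl (eq_leq (esym sd))
    (etrans (congr1 (fun x => minn x.-1 m) sd) (minn_idPl (ltnW dm))).
have lE (s l : 'I_n.+1) : s = d.+1 :> nat -> minn l.-1 m = t -> (t < l)%N -> l = s.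
  by move=> sd lt tl; apply: val_inj; rewrite /= sd;
    exact: (minn_pred_lt (leq_ltn_trans _ tl) dm lt).
split.
- move=> i j; rewrite ltnS leq_eqVlt => /orP[/eqP jd|]; last exact: P1.
  have sn : (d.+1 < n.+1)%N by rewrite ltnS (leq_trans dm) // ltnW.
  by have -> : j = t; [exact: val_inj | have [-> //] := H (Ordinal sn) erefl].
- move=> j /andP[j0]; rewrite leq_eqVlt => /orP[/eqP jd|]; last first.
    by rewrite ltnS => jd; apply: P2; rewrite j0.
  have [_ _ [l tl Pl] /(_ l tl Pl)[lt ->_]] := H j jd.
  by rewrite (lE j l jd lt tl).
move=> s sd; have [Pt low [l tl Pl] high] := H s sd.
have [lt _ wl] := high l tl Pl; have ls := lE s l sd lt tl.
(* The undetermined bit of the new column is [P t s]: [low] and [wl] give the rows above [t], and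
   [lE] shows that only row [s] can be nonzero after [t]. *)
rewrite {l}ls in tl Pl lt wl; exists (P t s) => i.
have [it|ti] := leqP i t; last first.
  have Bis : edge B i s = false.
    by rewrite edgeB /normal_edge sd /=; move: ti (c' _) => /=; clear -dm; lia.
  rewrite Bis mulr0 addr0; have [->//|is_] := eqVneq i s.
  apply/negP => Pis; have [it' _ _] := high i ti Pis.
  by rewrite (lE s i sd it' ti) eqxx in is_.
have -> : (i == s) = false.
  by rewrite -val_eqE /= sd ltn_eqF.
rewrite add0r; move: it; rewrite leq_eqVlt => /orP[/eqP it|it].
  rewrite (val_inj it).
  have -> : edge B t s = true by rewrite edgeB /normal_edge sd /= (minn_idPl (ltnW dm)) eqxx.
  by rewrite mulr1.
by rewrite low // wl // (ltn_trans it) ?sd.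
Qed.

(** At d = m the lemma [step] applies to every sink s, and P l s = 1 with l > m forces c s = c' l. A
    nonzero term of the determinant of P supplies the permutation, which fixes the path because
    those columns of P are standard. *)
Lemma normal_form_rigid :
  (forall j : nat, (0 < j <= m)%N -> c j = c' j) /\
  (exists2 s : 'S_n.+1, forall j : 'I_n.+1, (j <= m)%N -> s j = j
    & forall j : 'I_n.+1, (m < j)%N -> c' j = c (s j)).
Proof.
have cm := claimP (leqnn m); have [P1 P2 _] := cm.
have mn' : (m < n.+1)%N by rewrite ltnS ltnW.
have pr (s : nat) : (m < s)%N -> minn s.-1 m = m by clear; lia.
have H (s : 'I_n.+1) (ms : (m < s)%N) :=
  @step m s (Ordinal mn') cm (leqnn m) erefl ms (pr s ms).
have Pm (i j : 'I_n.+1) : (j <= m)%N -> P i j = (i == j).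
  rewrite leq_eqVlt => /orP[/eqP jm|]; last exact: P1.
  have -> : j = Ordinal mn' by exact: val_inj.
  by have [->] := H ord_max mn.
split=> [j jm|].
  have jn : (j < n.+1)%N by move: jm mn; clear; lia.
  exact: (P2 (Ordinal jn)).
have [s sP] : exists s : 'S_n.+1, forall i, P i (s i).
  have [/existsP[s /forallP sP]|/existsPn Pn] :=
    boolP [exists s : 'S_n.+1, forall i, P i (s i)]; first by exists s.
  move: Pu; rewrite unitmxE /determinant big1 ?unitr0 // => s _.
  have /forallPn[i Pi] := Pn s.
  by rewrite (bigD1 i) //= (negbTE Pi) mul0r mulr0.
have sm (i : 'I_n.+1) : (s i <= m)%N -> s i = i.
  by move=> sim; have := sP i; rewrite Pm // => /eqP/esym.
exists s => [j jm|j mj].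
  have := sm (s^-1%g j); rewrite permKV => /(_ jm) js.
  by rewrite [in LHS]js permKV.
have msj : (m < s j)%N.
  by rewrite ltnNge; apply/negP => /[dup] sjm /sm sj; rewrite sj leqNgt mj in sjm.
by have [_ _ _ /(_ j mj (sP j))[]] := H (s j) msj.
Qed.

End Rigidity.
End NormalForm.

(** * Reduction to the normal form *)

Section Chains.
Variable R : realType.

Section Fixed.
Variable n : nat.
Implicit Types (A B : 'M[bool]_n) (i j v : 'I_n) (o l : nat) (eps : nat -> bool).

(* Row [i] is [e_(i + 1) + eps_i row_(i + 1)] for [o <= i < l], and the
   vertices above [l] are sinks, all receiving an edge from [l]. *)
Definition chain o l eps A : Prop :=
  [/\ forall i i' j, i' = i.+1 :> nat -> (o <= i < l)%N ->
        edge A i j = (j == i') (+) (eps i && edge A i' j),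
      forall i j, i = l :> nat -> edge A i j = (i < j)%N
    & forall i j, (l < i)%N -> edge A i j = false].

Lemma chain_ext o l eps eps' A : (forall i : nat, (o <= i < l)%N -> eps i = eps' i) ->
  chain o l eps A -> chain o l eps' A.
Proof.
by move=> ee [A1 A2 A3]; split=> // i i' j ii' oil; rewrite -ee // -A1.
Qed.

(** Complementation adds A_iv row_v to row i. This is compatible with the recursion except at i + 1
    = v, where A_iv = 1 and eps_i is flipped. *)
Lemma chain_lc o l eps v A : (o < v <= l)%N -> chain o l eps A ->
  chain o l (fun i : nat => eps i (+) (i.+1 == v)) (local_complement v A).
Proof.
move=> /andP[ov vl] [A1 A2 A3]; split=> [i i' j ii' oil|i j il|i j li].
- have -> : (i.+1 == v)%N = (v == i') by rewrite -ii' eq_sym.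
  rewrite !edge_lc (A1 i i' j) // (A1 i i' v) //.
  have [->|_] := eqVneq v i'.
    rewrite [edge A i' i']/edge ltnn /= andbF addbF.
    by case: (eps i); case: (j == i'); case: (edge A i' j).
  by rewrite addbF -andbA -addbA -andb_addr.
- by rewrite edge_lc (A2 i j il) (A2 i v il) [(i < v)%N]ltnNge il vl addbF.
- by rewrite edge_lc (A3 i j li) (A3 i v li).
Qed.

(** The bits eps_d are cleared in increasing order by complementing at d + 1. Only vertices above
    [o] are used, so columns up to [o], later the edge 0 -> 1, survive. *)
Lemma chain_reduce o l eps A : (l < n)%N -> chain o l eps A ->
  exists A', [/\ affine_equivalent R A A', chain o l (fun=> false) A'
    & forall i j, (j <= o)%N -> edge A' i j = edge A i j].
Proof.
move=> ln cA.
suff [A' [AA' cA' oA']] : exists A', [/\ affine_equivalent R A A',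
    chain o l (fun i : nat => eps i && (l <= i)%N) A'
    & forall i j, (j <= o)%N -> edge A' i j = edge A i j].
  exists A'; split=> //; apply: chain_ext cA' => i /andP[_ il].
  by rewrite leqNgt il andbF.
elim: {2}l => [|d [A' [AA' cA' oA']]].
  exists A; split=> //; first exact: affine_equivalent_refl.
  by apply: chain_ext cA => i _; rewrite andbT.
have [/and3P[od dl ed]|skip] := boolP [&& o <= d, d < l & eps d]%N; last first.
  exists A'; split=> //; apply: chain_ext cA' => i /andP[oi il].
  rewrite ltn_neqAle eq_sym; have [id_|_ //] := eqVneq i d.
  by move: skip; rewrite -id_ oi il /= => /negbTE ->.
have dn : (d.+1 < n)%N by exact: leq_ltn_trans ln.
pose v := Ordinal dn; exists (local_complement v A'); split.
- exact: affine_equivalent_trans AA' (affine_equivalent_lc _ _ _).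
- have := @chain_lc o l _ v A' _ cA'; rewrite /= ltnS od dl => /(_ isT).
  apply: chain_ext => i _; rewrite eqSS [(d < i)%N]ltn_neqAle [d == i]eq_sym.
  by have [->|_] := eqVneq i d; rewrite ?ed ?leqnn ?addbF.
- move=> i j jo; rewrite edge_lc oA' // [edge A' v j]/edge /=.
  by rewrite ltnNge (leq_trans jo) ?andbF ?addbF // ltnW.
Qed.

Lemma chain_edge o l A i j : (l < n)%N -> chain o l (fun=> false) A -> (o <= i)%N ->
  edge A i j = (0 < j)%N && (i == minn j.-1 l :> nat).
Proof.
move=> ln [A1 A2 A3] oi; case: (ltngtP i l) => [il|li|il].
- have i1 : (i.+1 < n)%N by exact: leq_ltn_trans ln.
  rewrite (A1 i (Ordinal i1) j) ?oi //= addbF -val_eqE /=.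
  by move: il; clear; lia.
- by rewrite A3 //; move: li; clear; lia.
- by rewrite A2 // il; clear; lia.
Qed.

End Fixed.

(** The bit eps_r of B_j, rows counted from 1. In the second case it is 0 at r = m - 1, as that row
    stops at column m while row m reaches the sinks. *)
Definition list_eps (m j r : nat) : bool :=
  if (j <= m)%N then (j <= r)%N else (m - 1 - (j - m) <= r < m - 1)%N.

Lemma bott_list_entry_rec m j r c : (0 < r < m)%N -> (0 < j)%N -> (r < c)%N ->
  bott_list_entry m j r c =
  (c == r.+1) (+) (list_eps m j r && ((r.+1 < c)%N && bott_list_entry m j r.+1 c)).
Proof.
move=> /andP[r0 rm] j0 rc; rewrite /bott_list_entry /list_eps.
have [-> ->] : (m < r)%N = false /\ (r == m) = false by lia.
have -> : (m < r.+1)%N = false by lia.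
have -> : (c == r) = false by lia.
by repeat (case: leqP => ? /=); repeat (case: eqP => ? /=); lia.
Qed.

Variables m k : nat.
Hypotheses (m2 : (2 <= m)%N) (k2 : (2 <= k)%N).

Lemma bott_listE j (r c : 'I_(m + k)) :
  bott_list (m + k).+1 k j r c = bott_list_entry m j r.+1 c.+1.
Proof. by rewrite mxE; congr bott_list_entry; clear; lia. Qed.

Lemma chain_bott_list j : (0 < j)%N ->
  chain 0 m.-1 (fun i => list_eps m j i.+1) (bott_list (m + k).+1 k j).
Proof.
move=> j0; split=> [i i' l ii' im|i l im|i l im]; rewrite /edge ?bott_listE.
- have -> : (l == i') = (l.+1 == i.+2)%N by rewrite -ii' eqSS.
  have im1 : (i.+1 < m)%N by rewrite -ltn_predRL.
  rewrite ii'; case: ltnP => [il|li] /=; first by rewrite bott_list_entry_rec.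
  by rewrite eqSS ltn_eqF ?ltnS // ltnNge (leq_trans li) ?andbF.
- rewrite /bott_list_entry im prednK ?ltnn ?eqxx; last exact: ltnW.
  by case: ltnP => //= h; exact: leqW.
- rewrite /bott_list_entry; have -> : (m < i.+1)%N by rewrite ltnS (leq_trans (leqSpred m)).
  by rewrite eqSS; case: ltngtP.
Qed.

Lemma affine_equivalent_bott_list j j' : (0 < j)%N -> (0 < j')%N ->
  affine_equivalent R (bott_list (m + k).+1 k j) (bott_list (m + k).+1 k j').
Proof.
move=> j0 j'0; have mk : (m.-1 < m + k)%N by move: m2; clear; lia.
have [A [BA cA _]] := chain_reduce mk (chain_bott_list j0).
have [A' [BA' cA' _]] := chain_reduce mk (chain_bott_list j'0).
apply: affine_equivalent_trans BA _.
apply: affine_equivalent_trans (affine_equivalent_sym BA').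
apply: affine_equivalent_edge => i l.
by rewrite (chain_edge _ mk cA) // (chain_edge _ mk cA').
Qed.

Let N := (m + k).+1.
Let mN : (m < N)%N. Proof. by rewrite ltnS leq_addr. Qed.

(** Reduction leaves only row 0 undetermined; its edge to 1 extends the path, and a complementation
    at 1 normalises its entry in column 2. *)
Lemma chain_normal_form (A : 'M[bool]_N) eps : chain 1 m eps A ->
  edge A (inord 0) (inord 1) ->
  exists c, [/\ c 1%N = false, c 2 = false &
    affine_equivalent R A (normal_form N m c)].
Proof.
move=> cA A01.
have [A1 [AA1 cA1 A1E]] := chain_reduce mN cA.
have A101 : edge A1 (inord 0) (inord 1) by rewrite A1E // inordK // /N; lia.
pose v1 : 'I_N := inord 1.
have [n1 n2] : (1 < N)%N /\ (2 < N)%N by rewrite /N; lia.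
have v1E : v1 = 1%N :> nat by rewrite inordK.
have v2E : (inord 2 : 'I_N) = 2 :> nat by rewrite inordK.
have i0 (i : 'I_N) : (i < 1)%N -> i = inord 0.
  by rewrite ltnS leqn0 => /eqP i0; apply: val_inj; rewrite /= inordK.
have E1 j : edge A1 v1 j = (j == 2 :> nat).
  by rewrite (chain_edge _ mN cA1) ?v1E //; move: m2; clear; lia.
(* As m >= 2, the only out-neighbour of 1 is 2, so complementing at 1 toggles just 0 -> 2. *)
have [A2 [A1A2 A2E A202 A201]] : exists A2, [/\ affine_equivalent R A1 A2,
    forall i j : 'I_N, (0 < i)%N -> edge A2 i j = edge A1 i j,
    edge A2 (inord 0) (inord 2) = false & edge A2 (inord 0) (inord 1)].
  case A102 : (edge A1 (inord 0) (inord 2)); last first.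
    by exists A1; split=> //; exact: affine_equivalent_refl.
  exists (local_complement v1 A1); split; first exact: affine_equivalent_lc.
  - by move=> i j i_gt0; rewrite edge_lc [edge A1 i v1]/edge v1E ltnNge i_gt0 addbF.
  - by rewrite edge_lc A102 A101 E1 v2E.
  - by rewrite edge_lc A101 E1 v1E.
exists (fun j => (2 < j)%N && edge A2 (inord 0) (inord j)); split=> //.
apply: affine_equivalent_trans AA1 _; apply: affine_equivalent_trans A1A2 _.
apply: affine_equivalent_edge => i j; rewrite edge_normal /normal_edge.
have [|i_gt0] := ltnP i 1; last first.
  rewrite A2E // (chain_edge _ mN cA1) // [(nat_of_ord i == 0)%N]gtn_eqF //.
  by rewrite /= orbF.
move=> /i0 ->; rewrite inordK // eqxx /=.
case: (posnP j) => [j0|j0]; first by rewrite /edge j0 ltn0.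
have [j1|j1] := eqVneq (j : nat) 1%N.
  have -> : j = inord 1 by apply: val_inj; rewrite /= inordK.
  by rewrite A201 inordK // min0n.
have -> : (0 == minn j.-1 m)%N = false by move: j0 j1 m2; clear; lia.
have [j2|j2] := eqVneq (j : nat) 2.
  have -> : j = inord 2 by apply: val_inj; rewrite /= inordK.
  by rewrite A202 inordK.
by rewrite inord_val; have -> : (2 < j)%N by move: j0 j1 j2; clear; lia.
Qed.

End Chains.

(** * The parameters of the normal form *)

Section NormalFormData.

Lemma perm_of_card n (S U V : {set 'I_n}) : U \subset S -> V \subset S ->
  #|U| = #|V| -> exists s : 'S_n,
    (forall i, i \notin S -> s i = i) /\ (forall i, (s i \in V) = (i \in U)).
Proof.
move=> US VS cUV.
(* A colouring: a point outside S is its own colour, a point of S is coloured by membership in W.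
   Equal colour counts for U and V yield the permutation; [None] is only a default for [nth]. *)
pose f (W : {set 'I_n}) (i : 'I_n) : option ('I_n + bool) :=
  if i \in S then Some (inr (i \in W)) else Some (inl i).
have cf (W : {set 'I_n}) (y : option ('I_n + bool)) : W \subset S -> #|[pred i | f W i == y]| =
    match y with
    | Some (inl i) => (i \notin S) : nat
    | Some (inr b) => if b then #|W| else (#|S| - #|W|)%N
    | None => 0
    end.
  move=> WS; case: y => [[j|b]|].
  - case jS : (j \in S).
      apply: eq_card0 => i; rewrite inE /f; case: ifP => // iS.
      by apply/eqP => -[ij]; rewrite ij jS in iS.
    rewrite /= -(card1 j); apply: eq_card => i; rewrite !inE /f.
    case: ifP => iS; last by [].
    by symmetry; apply/negbTE; apply: contraTneq iS => ->; rewrite jS.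
  - have <- : #|S :\: W| = (#|S| - #|W|)%N by rewrite cardsD (finset.setIidPr WS).
    case: b.
      apply: eq_card => i; rewrite !inE /f; case: ifP => iS.
        by case: (i \in W).
      by symmetry; apply/negbTE; apply: contraFN iS; exact: (fintype.subsetP WS).
    apply: eq_card => i; rewrite !inE /f; case: (i \in S); last by rewrite andbF.
    by rewrite andbT; case: (i \in W).
  - by apply: eq_card0 => i; rewrite inE /f; case: ifP.
have : perm_eq [tuple f U i | i < n] [tuple f V i | i < n].
  apply/allP => y _ /=; rewrite !count_map.
  have cE W : count (preim (f W) (pred1 y)) (enum 'I_n) = #|[pred i | f W i == y]|.
    by rewrite -sum1_count big_enum_cond -sum1_card; apply: eq_bigl => i; rewrite !inE.
  rewrite -!enumT; apply/eqP; apply: etrans (cE U) _; apply: esym.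
  by apply: etrans (cE V) _; rewrite !cf // cUV.
move=> /tuple_permP[s sE]; exists s.
have fs i : f U i = f V (s i).
  have := congr1 (fun t => nth None t i) sE.
  by rewrite -!tnth_nth !tnth_mktuple.
split=> i => [iS|].
  have := fs i; rewrite /f (negbTE iS); case: ifP => // _ [].
  by move=> <-.
have := fs i; rewrite /f; case: ifP => iS; case: ifP => sS //; first by move=> [->].
move=> _; transitivity false; first by apply: contraFF sS; exact: (fintype.subsetP VS).
by symmetry; apply: contraFF iS; exact: (fintype.subsetP US).
Qed.

Variables m k : nat.
Hypotheses (m2 : (2 <= m)%N) (k2 : (2 <= k)%N).
Let N := (m + k).+1.
Let mN : (m < N)%N. Proof. by rewrite ltnS leq_addr. Qed.

Definition param : finType := ((m - 2).-tuple bool * 'I_k.+1)%type.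

(** Sinks can be permuted freely, so the first [q.2] of them represent any choice of that many. The
    bits start at vertex 3 because 1 and 2 are normalised. *)
Definition param_edge (q : param) (j : nat) : bool :=
  if (j <= m)%N then (2 < j)%N && nth false q.1 (j - 3) else (j - m.+1 < q.2)%N.

Definition sinks (c : nat -> bool) : {set 'I_N} := [set i : 'I_N | (m < i)%N && c i]%SET.

Lemma card_sinks_all : #|sinks xpredT| = k.
Proof.
pose f (i : 'I_k) : 'I_N := inord (m.+1 + i).
have fE i : f i = (m.+1 + i)%N :> nat.
  by rewrite inordK // /N ltnS addSn ltn_add2l.
have finj : injective f.
  by move=> i i' /(congr1 val); rewrite /= !fE => /addnI/val_inj.
rewrite -[RHS]card_ord -(card_imset _ finj); apply: eq_card => i.
rewrite inE andbT; apply/idP/imsetP => [mi|[i' _ ->]]; last by rewrite fE addSn ltnS leq_addr.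
have ik : (i - m.+1 < k)%N by rewrite ltn_subLR // addSn.
by exists (Ordinal ik) => //; apply: val_inj; rewrite /= fE /= subnKC.
Qed.

Lemma card_sinks_param q : #|sinks (param_edge q)| = q.2.
Proof.
have qk : (q.2 <= k)%N by rewrite -ltnS ltn_ord.
pose f (i : 'I_q.2) : 'I_N := inord (m.+1 + i).
have fE i : f i = (m.+1 + i)%N :> nat.
  by rewrite inordK // /N ltnS addSn ltn_add2l (leq_trans (ltn_ord i)).
have finj : injective f.
  by move=> i i' /(congr1 val); rewrite /= !fE => /addnI/val_inj.
rewrite -[RHS]card_ord -(card_imset _ finj); apply: eq_card => i.
rewrite inE /param_edge; apply/andP/imsetP => [[mi]|[i' _ ->]].
  rewrite leqNgt mi /= => ik.
  by exists (Ordinal ik) => //; apply: val_inj; rewrite /= fE /= subnKC.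
by rewrite fE addSn ltnS leq_addr [(_ <= m)%N]leqNgt ltnS leq_addr /= subSS addKn.
Qed.

Lemma normal_form_param (R : realType) c : c 1%N = false -> c 2 = false ->
  exists q, affine_equivalent R (normal_form N m c) (normal_form N m (param_edge q)).
Proof.
move=> c1 c2.
have pk : (#|sinks c| < k.+1)%N.
  rewrite ltnS -[leqRHS]card_sinks_all subset_leq_card //.
  by apply/fintype.subsetP => i; rewrite !inE andbT => /andP[].
pose q : param := ([tuple c (i + 3)%N | i < m - 2], Ordinal pk).
have qE j : (0 < j <= m)%N -> param_edge q j = c j.
  move=> /andP[j0 jm]; rewrite /param_edge jm.
  case: (ltnP 2 j) => j2 /=; last by case: j j0 j2 {jm} => [|[|[|]]] // _ _; rewrite ?c1 ?c2.
  have jm3 : (j - 3 < m - 2)%N by move: jm j2 m2; clear; lia.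
  by rewrite (nth_map (Ordinal jm3)) ?size_enum_ord // nth_enum_ord // subnK.
have [s [sS sV]] := @perm_of_card N (sinks xpredT) (sinks c) (sinks (param_edge q))
  (ltac:(by apply/fintype.subsetP => i; rewrite !inE andbT => /andP[]))
  (ltac:(by apply/fintype.subsetP => i; rewrite !inE andbT => /andP[]))
  (esym (card_sinks_param q)).
have sm (i : 'I_N) : (i <= m)%N -> s i = i by move=> im; apply: sS; rewrite inE andbT -leqNgt.
have ms (i : 'I_N) : (m < i)%N -> (m < s i)%N.
  move=> mi; rewrite ltnNge; apply: contraTN mi => sim.
  by rewrite -leqNgt -(perm_inj (sm _ sim)).
exists q; apply: (@affine_equivalent_perm R N s) => i j; rewrite !edge_normal /normal_edge.
have [im|mi] := leqP i m; last first.
  have min_lt (a b : nat) : (m < a)%N -> (a == minn b m) = false by clear; lia.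
  by rewrite !min_lt ?ms // !gtn_eqF
    ?(leq_ltn_trans _ (ms _ mi)) ?(leq_ltn_trans _ mi) //= !andbF.
rewrite (sm i im); have [jm|mj] := leqP j m.
  rewrite (sm j jm); case: posnP => //= j0; by rewrite qE // j0.
have msj := ms j mj.
have minE (a : nat) : (m < a)%N -> minn a.-1 m = m by clear; lia.
rewrite !minE // (leq_ltn_trans _ mj) // (leq_ltn_trans _ msj) //=.
by have := sV j; rewrite !inE mj msj /= => ->.
Qed.

(** Rigidity gives equality of the bits and a permutation matching the sinks reached from 0, hence
    equality of their numbers. *)
Lemma normal_form_inj (q q' : param) :
  parity_iso (normal_form N m (param_edge q')) (normal_form N m (param_edge q)) -> q = q'.
Proof.
move=> [phi phiM [P Pu phiP]].
have mn : (m < m + k)%N by rewrite -[ltnLHS]addn0 ltn_add2l ltnW.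
have p1 q0 : param_edge q0 1%N = false by rewrite /param_edge ltnW.
have p2 q0 : param_edge q0 2 = false by rewrite /param_edge m2.
have [cE [s sm sP]] := normal_form_rigid m2 mn (p1 q) (p2 q) (p1 q') (p2 q') Pu
  (parity_relation phiM phiP).
have -> : q = (q.1, q.2) by case: (q).
have -> : q' = (q'.1, q'.2) by case: (q').
congr pair.
  apply: eq_from_tnth => i; rewrite !(tnth_nth false).
  have im : (0 < i + 3 <= m)%N by have := ltn_ord i; move: m2; clear; lia.
  have := cE (i + 3)%N im; rewrite /param_edge; have /andP[_ ->] := im.
  by rewrite addnK addn3.
apply: val_inj; rewrite /= -!card_sinks_param -(card_preimset _ (@perm_inj _ s)).
apply: eq_card => j; rewrite !inE; have [jm|mj] := leqP j m.
  by rewrite sm // ltnNge jm.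
rewrite sP //; suff -> : (m < s j)%N by [].
rewrite ltnNge; apply: contraTN mj => sjm.
by rewrite -leqNgt -(perm_inj (sm _ sjm)).
Qed.

End NormalFormData.

(** * The circle bundles over the listed manifolds *)

Section CircleBundles.

(** B_m is the path itself, all its eps_r with r < m being 0; it is the base over which every normal
    form is realised. *)
Lemma bott_list_entry_path m r l c : (0 < r)%N -> (0 < l)%N ->
  bott_list_entry m m r l = (r == l) || normal_edge m c r l.
Proof.
move=> r0 l0; rewrite /bott_list_entry /normal_edge leqnn l0 [r == 0]gtn_eqF // orbF.
by repeat (case: ltnP => ? /=); repeat (case: eqP => ? /=); lia.
Qed.

Variables m k : nat.
Hypotheses (m2 : (2 <= m)%N) (k2 : (2 <= k)%N).
Let N := (m + k).+1.

(** The extra first row and column shift indices by one, so indices of A from 0 are indices of B_j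
    from 1. *)
Lemma circle_bundle_entry j (A : 'M[bool]_(1 + (m + k))) (i l : 'I_(1 + (m + k))) :
  circle_bundle_form A (bott_list N k j) -> (0 < i)%N -> (0 < l)%N ->
  A i l = bott_list_entry m j i l.
Proof.
move=> /andP[/existsP[c /eqP ->] _].
case: (split_ordP i) => i' ->; first by rewrite ord1.
case: (split_ordP l) => l' ->; first by rewrite ord1.
by move=> _ _; rewrite block_mxEdr bott_listE.
Qed.

(** By triangularity column 1 has nonzero entries at most in rows 0 and 1, and it must have two. *)
Lemma circle_bundle_edge01 j (A : 'M[bool]_N) : bott_matrix A -> (0 < j)%N ->
  circle_bundle_form (A : 'M[bool]_(1 + (m + k))) (bott_list N k j) ->
  edge A (inord 0) (inord 1).
Proof.
move=> bA j0 /andP[_ /forallP/(_ (inord 1))].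
have v1E : (inord 1 : 'I_N) = 1%N :> nat by rewrite inordK // /N; lia.
rewrite v1E /=.
rewrite /edge v1E inordK //=; apply: contraTT => A01; rewrite -leqNgt.
apply: (@leq_trans #|[set (inord 1 : 'I_N)]%SET|); last by rewrite cards1.
apply/subset_leq_card/fintype.subsetP => i.
rewrite !inE => Ai1; have /andP[_ /forallP/(_ i)/forallP/(_ (inord 1))] := bA.
rewrite Ai1 v1E implybF -leqNgt => i1.
case: (ltngtP i 1) i1 => // [i0|i1] _; last by apply/eqP/val_inj; rewrite /= v1E.
suff i0E : i = inord 0 by rewrite -i0E Ai1 in A01.
by apply: val_inj; rewrite /= inordK //; move: i0; case: (nat_of_ord i).
Qed.

Lemma chain_circle_bundle j (A : 'M[bool]_N) : bott_matrix A -> (0 < j)%N ->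
  circle_bundle_form (A : 'M[bool]_(1 + (m + k))) (bott_list N k j) ->
  chain 1 m (list_eps m j) A.
Proof.
move=> bA j0 fA; have AE := circle_bundle_entry fA.
split=> [i i' l ii' /andP[i0 im]|i l im|i l mi]; rewrite /edge.
- case: (ltnP i l) => [il|li] /=; last first.
    by rewrite -val_eqE /= ii' ltn_eqF // ltnNge (leq_trans li) //= andbF.
  have l0 : (0 < l)%N by exact: leq_trans il.
  by rewrite !AE ?ii' // bott_list_entry_rec ?i0 // -val_eqE /= ii'.
- case: ltnP => //= il; rewrite AE ?im; last 2 first.
  + by rewrite ltnW.
  + exact: leq_trans il.
  by move: il; rewrite /bott_list_entry ltnn eqxx im; exact: ltnW.
- case: ltnP => //= il; rewrite AE; last 2 first.
  + exact: leq_trans mi.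
  + exact: leq_trans il.
  by rewrite /bott_list_entry mi gtn_eqF.
Qed.

Lemma bott_normal_form n c : bott_matrix (normal_form n m c).
Proof.
apply/andP; split; apply/forallP => i; first by rewrite mxE eqxx.
apply/forallP => j; apply/implyP => ji; rewrite mxE -val_eqE /= gtn_eqF //=.
by have := edge_normal m c i j; rewrite /edge ltnNge ltnW //= => <-.
Qed.

Lemma circle_bundle_normal_form c :
  circle_bundle_form (normal_form N m c : 'M[bool]_(1 + (m + k))) (bott_list N k m).
Proof.
pose M : 'M[bool]_(1 + (m + k)) := normal_form N m c.
apply/andP; split.
  apply/existsP; exists (\row_j M 0 (rshift 1 j)); apply/eqP/matrixP => i j.
  case: (split_ordP i) => i' ->; case: (split_ordP j) => j' ->.
  - by rewrite block_mxEul !mxE !ord1.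
  - by rewrite block_mxEur [RHS]mxE ord1; congr (M _ _); apply: val_inj.
  - by rewrite block_mxEdl !mxE ord1.
  - rewrite block_mxEdr bott_listE (@normal_formE N).
    by rewrite (@bott_list_entry_path _ _ _ c) // -val_eqE.
apply/forallP => j; apply/implyP => j0.
(* The two nonzero entries of column j are the diagonal one and that of the path predecessor. *)
have pj : (minn j.-1 m < N)%N by rewrite ltnS geq_min leq_addr orbT.
have <- : #|[set j; (Ordinal pj : 'I_(1 + (m + k)))]%SET| = 2%N.
  by rewrite cards2 -val_eqE /= neq_ltn gtn_min ltn_predL j0 orbT.
apply/subset_leq_card/fintype.subsetP => i; rewrite !inE => /orP[/eqP ->|/eqP ->].
  by rewrite mxE eqxx.
by rewrite mxE /normal_edge j0 eqxx orbT.
Qed.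

Lemma param_of_circle_bundle (R : realType) j (A : 'M[bool]_N) :
  bott_matrix A -> (0 < j)%N ->
  circle_bundle_form (A : 'M[bool]_(1 + (m + k))) (bott_list N k j) ->
  exists q : param m k, affine_equivalent R A (normal_form N m (param_edge q)).
Proof.
move=> bA j0 fA.
have [c [c1 c2 Ac]] := chain_normal_form R m2 k2 (chain_circle_bundle bA j0 fA)
  (circle_bundle_edge01 bA j0 fA).
have [q cq] := @normal_form_param m k m2 R c c1 c2.
by exists q; exact: affine_equivalent_trans Ac cq.
Qed.

End CircleBundles.

(** [label] is a complete invariant whose values are all realised by [F], so classes correspond to
    elements of Q. It is a relation because labels come from an existence statement. *)
Lemma card_equivalence_classes (T Q : finType) (r : rel T) (D : {set T})
    (label : T -> Q -> Prop) (F : Q -> T) :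
  (forall q, F q \in D) -> (forall q, label (F q) q) ->
  (forall x, x \in D -> exists q, label x q) ->
  (forall x y q q', label x q -> label y q' -> r x y = (q == q')) ->
  #|equivalence_partition r D| = #|Q|.
Proof.
move=> FD Fl Dl lr; pose cls x := [set y in D | r x y]%SET.
have <- : #|(cls \o F) @: [set: Q]%SET| = #|Q|.
  rewrite card_imset ?cardsT // => q q' /= /setP/(_ (F q')).
  by rewrite !inE FD /= !(lr _ _ _ _ (Fl _) (Fl _)) eqxx => /eqP.
apply: eq_card => X; apply/imsetP/imsetP => [[x xD ->]|[q _ ->]]; last by exists (F q).
have [q xq] := Dl x xD; exists q => //; apply/setP => y; rewrite !inE.
case yD : (y \in D) => //=; have [q' yq'] := Dl y yD.
by rewrite (lr _ _ _ _ xq yq') (lr _ _ _ _ (Fl q) yq').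
Qed.

Local Close Scope quotient_scope.
Local Close Scope ring_scope.
Local Close Scope classical_set_scope.

Theorem theoremD (R : realType) (n k : nat) (hk : 2 <= k) (hn : k + 3 <= n) :
  (forall j j' : nat,
     1 <= j <= 2 * (n - k) - 4 -> 1 <= j' <= 2 * (n - k) - 4 ->
     diffeomorphic R (bott_list n k j) (bott_list n k j')) /\
  #|equivalence_partition
      (fun A A' : 'M[bool]_(1 + n.-1) => `[< diffeomorphic R A A' >])
      [set A : 'M[bool]_(1 + n.-1) | bott_matrix A &&
         has (fun j => circle_bundle_form A (bott_list n k j))
             (iota 1 (2 * (n - k) - 4))]%SET|
  = (k + 1) * 2 ^ (n - k - 3).
Proof.
pose m := n - k - 1; have m2 : 2 <= m by rewrite /m; lia.
have nE : n = (m + k).+1 by rewrite /m; lia.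
clearbody m; subst n.
split=> [j j' /andP[j0 _] /andP[j'0 _]|].
  exact/affine_equivalent_diffeomorphic/affine_equivalent_bott_list.
have -> : (k + 1) * 2 ^ ((m + k).+1 - k - 3) = #|param m k|.
  rewrite card_prod card_tuple card_bool card_ord mulnC addn1.
  by congr (2 ^ _ * _); lia.
pose F (q : param m k) : 'M[bool]_(1 + (m + k)) := normal_form (m + k).+1 m (param_edge q).
have DF A : A \in [set A : 'M[bool]_(1 + (m + k)) | bott_matrix A &&
    has (fun j => circle_bundle_form A (bott_list (m + k).+1 k j))
      (iota 1 (2 * ((m + k).+1 - k) - 4))]%SET -> exists q, affine_equivalent R A (F q).
  rewrite inE => /andP[bA /hasP[j]]; rewrite mem_iota => /andP[j0 _] fA.
  exact: param_of_circle_bundle bA j0 fA.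
apply: (card_equivalence_classes (F := F)
  (label := fun A q => affine_equivalent R A (F q))) DF _ => [q|q|A A' q q' Aq A'q'].
(* B_m is in the list because m <= 2 m - 2. *)
- rewrite inE bott_normal_form; apply/hasP; exists m.
    by rewrite mem_iota; lia.
  exact: circle_bundle_normal_form.
- exact: affine_equivalent_refl.
apply/asboolP/eqP => [/diffeomorphic_parity_iso AA'|qq'].
  have iso B C : affine_equivalent R B C -> parity_iso B C.
    by move=> /affine_equivalent_diffeomorphic; exact: diffeomorphic_parity_iso.
  symmetry; apply: (normal_form_inj m2 hk).
  apply: parity_iso_trans (iso _ _ _ (affine_equivalent_sym Aq)) _.
  exact: parity_iso_trans AA' (iso _ _ _ A'q').
apply: affine_equivalent_diffeomorphic; apply: affine_equivalent_trans Aq _.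
by rewrite qq'; exact: affine_equivalent_sym.
Qed.
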